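(* Let $(d_k)_{k=1}^\infty$ and $(N_k)_{k=1}^\infty$ be sequences of natural numbers such that $(d_k)$ is lacunary, $N_k\mid N_{k+1}$ and $N_k<N_{k+1}$ for all $k$. Put \[A_k=\{(n_1,n_2)\in\mathbb{N}\times\mathbb{N}: n_1+n_2=d_k\},\qquad B_k=\{(n_1,n_2)\in A_k: N_k\mid n_1\},\qquad B=\bigcup_{k=1}^\infty B_k.\] Then the following are equivalent: (i) there exist constants $a,C$ such that $d_k\le C N_{k+a}$ for all $k$; (ii) $B$ belongs to the idempotent ring of $H^1(\mathbb{T}\times\mathbb{T})$, i.e. the operator $T$ defined on trigonometric polynomials in $H^1(\mathbb{T}\times\mathbb{T})$ by $\widehat{Tf}=\mathbbm{1}_B\widehat f$ extends to a bounded operator $H^1(\mathbb{T}\times\mathbb{T})\to H^1(\mathbb{T}\times\mathbb{T})$.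
   Context: $\mathbb{N}=\{0,1,2,\dots\}$. A sequence $(d_k)$ of positive integers is lacunary if $\inf_k d_{k+1}/d_k>1$. $\mathbb{T}=\mathbb{R}/2\pi\mathbb{Z}$ with normalized Lebesgue measure. $H^1(\mathbb{T}\times\mathbb{T})$ is the closed linear span in $L^1(\mathbb{T}^2)$ of the characters $e^{i(n_1t_1+n_2t_2)}$ with $n_1,n_2\ge 0$. The idempotent ring of $H^1(\mathbb{T}\times\mathbb{T})$ is the family of sets $E\subset\mathbb{N}\times\mathbb{N}$ for which the Fourier multiplier $\mathbbm{1}_E$ is bounded on $H^1(\mathbb{T}\times\mathbb{T})$. *)

(* Defs.v *)
From Stdlib Require Import Reals Lra List ClassicalDescription.
From Coquelicot Require Import Coquelicot.
Import ListNotations.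
Open Scope R_scope.

Definition lacunary (d : nat -> nat) : Prop :=
  (forall k, (0 < d k)%nat) /\
  exists q : R, 1 < q /\ forall k, q * INR (d k) <= INR (d (S k)).

Definition eC (theta : R) : C := (cos theta, sin theta).

(* An analytic trigonometric polynomial on T^2 (an element of H^1(T x T)),
   given as a finite list of (n1, n2, coefficient) with n1, n2 >= 0. *)
Definition trigpoly := list (nat * nat * C).

Definition trig_eval (p : trigpoly) (t1 t2 : R) : C :=
  fold_right (fun x acc => let '(n1, n2, c) := x in
     Cplus (Cmult c (eC (INR n1 * t1 + INR n2 * t2))) acc) (RtoC 0) p.

Definition L1norm (p : trigpoly) : R :=
  / (4 * PI ^ 2) *
  RInt (fun t1 => RInt (fun t2 => Cmod (trig_eval p t1 t2)) 0 (2 * PI)) 0 (2 * PI).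

Definition ind (E : nat -> nat -> Prop) (n1 n2 : nat) : bool :=
  if excluded_middle_informative (E n1 n2) then true else false.

Definition multiplier (E : nat -> nat -> Prop) (p : trigpoly) : trigpoly :=
  filter (fun x => let '(n1, n2, _) := x in ind E n1 n2) p.

(* E is in the idempotent ring of H^1(T x T): the multiplier 1_E, defined on
   analytic trigonometric polynomials, is bounded in the H^1 (= L^1) norm
   (hence extends to a bounded operator on their closure H^1). *)
Definition in_idempotent_ring (E : nat -> nat -> Prop) : Prop :=
  exists K : R, forall p : trigpoly, L1norm (multiplier E p) <= K * L1norm p.

Definition setB (d N : nat -> nat) (n1 n2 : nat) : Prop :=
  exists k : nat, (n1 + n2)%nat = d k /\ Nat.divide (N k) n1.

(* Main.v *)
(** The grid [{(w ^ x, w ^ y)}], [w] a primitive [M]-th root of unity, turns the L1 norm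
    into a limit of finite averages. On the grid put [z1 = z s], [z2 = s]: the part of
    degree [d_k] of [f] becomes [s ^ d_k g_k(z)] with [g_k] of degree at most [d_k], and
    the multiplier acts as [g_k |-> E_k g_k], the average over rotations by the
    [N_k]-th roots of unity. As [(d_k)] is lacunary, Paley's inequality and Parseval's
    identity in [s] reduce the boundedness of the multiplier to
      [mean (sum |E_k g_k|^2)^(1/2) <= C mean (sum |g_k|^2)^(1/2)].

    If [d_k <= C N_(k+a)] one may assume [d_k <= N_(k+1)] after splitting [k] modulo a
    fixed stride. Then [g_k] is almost constant at scale [1 / N_(k+1)] while [E_k g_k]
    only remembers positions modulo [1 / N_k], and the inequality is a decoupling
    inequality for tangent sequences: with [Phi a x = sqrt (a^2 + x^2) - a] the square
    function is the sum of the increments [Phi a_k |g_k|], and these are compared one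
    at a time, [a_k] being a majorant of the past that varies slowly at scale [1 / N_k].

    If [d_k > 2 N_(k+a)], all [g_k, ..., g_(k+a)] may be taken equal to one Fejer kernel
    concentrated at [1]; the averages [E_(k+j)] spread it over the [N_(k+j)]-th roots of
    unity, and the left side is of order [a] while the right side is of order [sqrt a]. *)
Require Import Defs.
From Stdlib Require Import Reals Lra Lia Classical.
From Coquelicot Require Import Coquelicot.
Open Scope R_scope.

(** * Riemann sums for the norm *)

Fixpoint nsum (f : nat -> R) (n : nat) : R :=
  match n with O => 0 | S n => nsum f n + f n end.

Lemma nsum_scal c f n : nsum (fun i => c * f i) n = c * nsum f n.
Proof. induction n as [|n IH]; simpl; [ring|rewrite IH; ring]. Qed.

Lemma nsum_diff_le f g B n : (forall i, Rabs (f i - g i) <= B) ->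
  Rabs (nsum f n - nsum g n) <= INR n * B.
Proof.
intros H; induction n as [|n IH].
- simpl; rewrite Rminus_0_r, Rabs_R0; lra.
- rewrite S_INR; simpl.
  replace (nsum f n + f n - (nsum g n + g n))
    with ((nsum f n - nsum g n) + (f n - g n)) by ring.
  eapply Rle_trans; [apply Rabs_triang|]; specialize (H n); lra.
Qed.

Definition lipschitz (f : R -> R) (L : R) :=
  forall x y, Rabs (f x - f y) <= L * Rabs (x - y).

Lemma lipschitz_continuous f L : 0 <= L -> lipschitz f L -> forall x, continuous f x.
Proof.
intros L0 H x; apply filterlim_locally; intros eps.
assert (d0 : 0 < eps / (L + 1)) by (apply Rdiv_lt_0_compat; [apply cond_pos|lra]).
exists (mkposreal _ d0); intros y Hy.
change (Rabs (y - x) < eps / (L + 1)) in Hy.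
change (Rabs (f y - f x) < eps).
eapply Rle_lt_trans; [apply H|].
apply Rle_lt_trans with (L * (eps / (L + 1))).
- apply Rmult_le_compat_l; lra.
- apply Rlt_le_trans with ((L + 1) * (eps / (L + 1))).
  + apply Rmult_lt_compat_r; lra.
  + right; field; lra.
Qed.

Lemma lipschitz_ex_RInt f L a b : 0 <= L -> lipschitz f L -> ex_RInt f a b.
Proof.
intros L0 H; apply (@ex_RInt_continuous R_CompleteNormedModule).
intros z _; now apply (lipschitz_continuous f L).
Qed.

Lemma RInt_rectangle f L a b : 0 <= L -> lipschitz f L -> a <= b ->
  Rabs (RInt f a b - (b - a) * f a) <= L * (b - a) ^ 2.
Proof.
intros L0 H ab.
assert (ef := lipschitz_ex_RInt f L a b L0 H).
assert (ec : ex_RInt (fun _ : R => f a) a b) by apply ex_RInt_const.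
replace (RInt f a b - (b - a) * f a) with (RInt (fun t => minus (f t) (f a)) a b).
- replace (L * (b - a) ^ 2) with ((b - a) * (L * (b - a))) by ring.
  apply abs_RInt_le_const; auto.
  + now apply (@ex_RInt_minus R_CompleteNormedModule).
  + intros t Ht; eapply Rle_trans; [apply H|].
    apply Rmult_le_compat_l; auto; rewrite Rabs_right; lra.
- rewrite (@RInt_minus R_CompleteNormedModule), RInt_const; auto.
Qed.

Lemma riemann_sum f L h n : 0 <= L -> lipschitz f L -> 0 <= h ->
  Rabs (RInt f 0 (INR n * h) - h * nsum (fun i => f (INR i * h)) n)
    <= INR n * (L * h ^ 2).
Proof.
intros L0 H h0; induction n as [|n IH].
- simpl (INR 0); rewrite Rmult_0_l, RInt_point; simpl.
  change (@zero R_CompleteNormedModule) with 0.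
  rewrite Rmult_0_r, Rminus_0_r, Rabs_R0; lra.
- rewrite S_INR; simpl nsum.
  assert (e : forall a b, ex_RInt f a b) by (intros; now apply lipschitz_ex_RInt with L).
  rewrite <- (RInt_Chasles f 0 (INR n * h) ((INR n + 1) * h)); auto.
  change plus with Rplus.
  assert (st := RInt_rectangle f L (INR n * h) ((INR n + 1) * h) L0 H).
  replace ((INR n + 1) * h - INR n * h) with h in st by ring.
  specialize (st ltac:(lra)).
  replace (RInt f 0 (INR n * h) + RInt f (INR n * h) ((INR n + 1) * h)
      - h * (nsum (fun i => f (INR i * h)) n + f (INR n * h)))
    with ((RInt f 0 (INR n * h) - h * nsum (fun i => f (INR i * h)) n)
      + (RInt f (INR n * h) ((INR n + 1) * h) - h * f (INR n * h))) by ring.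
  eapply Rle_trans; [apply Rabs_triang|]; lra.
Qed.

Lemma cos_lipschitz a b : Rabs (cos a - cos b) <= Rabs (a - b).
Proof.
destruct (MVT_abs cos (fun x => - sin x) b a) as [c [Hc _]].
- intros c _; apply derivable_pt_lim_cos.
- rewrite Hc, Rabs_Ropp.
  assert (Rabs (sin c) <= 1) by (apply Rabs_le; destruct (SIN_bound c); lra).
  assert (h := Rabs_pos (a - b)); nra.
Qed.

Lemma sin_lipschitz a b : Rabs (sin a - sin b) <= Rabs (a - b).
Proof.
destruct (MVT_abs sin cos b a) as [c [Hc _]].
- intros c _; apply derivable_pt_lim_sin.
- rewrite Hc.
  assert (Rabs (cos c) <= 1) by (apply Rabs_le; destruct (COS_bound c); lra).
  assert (h := Rabs_pos (a - b)); nra.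
Qed.

Lemma Cmod_le_abs (x y : R) : Cmod (x, y) <= Rabs x + Rabs y.
Proof.
unfold Cmod; simpl fst; simpl snd.
assert (0 <= Rabs x) by apply Rabs_pos; assert (0 <= Rabs y) by apply Rabs_pos.
rewrite <- (sqrt_pow2 (Rabs x + Rabs y)) by lra.
apply sqrt_le_1_alt.
rewrite <- (pow2_abs x), <- (pow2_abs y); nra.
Qed.

Lemma eC_lipschitz a b : Cmod (Cminus (eC a) (eC b)) <= 2 * Rabs (a - b).
Proof.
unfold eC, Cminus, Cplus, Copp; simpl.
eapply Rle_trans; [apply Cmod_le_abs|].
assert (h1 := cos_lipschitz a b); assert (h2 := sin_lipschitz a b).
unfold Rminus in *; lra.
Qed.

Lemma trig_eval_lipschitz p : exists L, 0 <= L /\ forall t1 t2 s1 s2,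
  Cmod (Cminus (trig_eval p t1 t2) (trig_eval p s1 s2))
    <= L * (Rabs (t1 - s1) + Rabs (t2 - s2)).
Proof.
induction p as [|[[n1 n2] c] p [L [L0 IH]]].
- exists 0; split; [lra|intros; simpl].
  replace (Cminus (RtoC 0) (RtoC 0)) with (RtoC 0) by ring.
  rewrite Cmod_0; lra.
- exists (L + Cmod c * (2 * (INR n1 + INR n2))).
  assert (c0 := Cmod_ge_0 c); assert (p1 := pos_INR n1); assert (p2 := pos_INR n2).
  split; [nra|intros t1 t2 s1 s2; simpl].
  specialize (IH t1 t2 s1 s2).
  set (A := eC (INR n1 * t1 + INR n2 * t2)); set (B := eC (INR n1 * s1 + INR n2 * s2)).
  replace (Cminus (Cplus (Cmult c A) (trig_eval p t1 t2))
      (Cplus (Cmult c B) (trig_eval p s1 s2)))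
    with (Cplus (Cmult c (Cminus A B)) (Cminus (trig_eval p t1 t2) (trig_eval p s1 s2)))
    by ring.
  eapply Rle_trans; [apply Cmod_triangle|]; rewrite Cmod_mult.
  assert (hA : Cmod (Cminus A B)
      <= 2 * (INR n1 + INR n2) * (Rabs (t1 - s1) + Rabs (t2 - s2))).
  { unfold A, B; eapply Rle_trans; [apply eC_lipschitz|].
    rewrite Rmult_assoc; apply Rmult_le_compat_l; [lra|].
    replace (INR n1 * t1 + INR n2 * t2 - (INR n1 * s1 + INR n2 * s2))
      with (INR n1 * (t1 - s1) + INR n2 * (t2 - s2)) by ring.
    eapply Rle_trans; [apply Rabs_triang|].
    rewrite !Rabs_mult, (Rabs_right (INR n1)), (Rabs_right (INR n2)) by lra.
    assert (q1 := Rabs_pos (t1 - s1)); assert (q2 := Rabs_pos (t2 - s2)); nra. }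
  assert (Cmod c * Cmod (Cminus A B)
    <= Cmod c * (2 * (INR n1 + INR n2) * (Rabs (t1 - s1) + Rabs (t2 - s2))))
    by now apply Rmult_le_compat_l.
  lra.
Qed.

Lemma Cmod_diff x y : Rabs (Cmod x - Cmod y) <= Cmod (Cminus x y).
Proof.
apply Rabs_le; split.
- assert (h := Cmod_triangle (Cminus y x) x).
  replace (Cplus (Cminus y x) x) with y in h by ring.
  replace (Cminus y x) with (Copp (Cminus x y)) in h by ring.
  rewrite Cmod_opp in h; lra.
- assert (h := Cmod_triangle (Cminus x y) y).
  replace (Cplus (Cminus x y) y) with x in h by ring; lra.
Qed.

Definition grid_sum (p : trigpoly) (M : nat) : R :=
  nsum (fun i => nsum (fun j =>
    Cmod (trig_eval p (INR i * (2 * PI / INR M)) (INR j * (2 * PI / INR M)))) M) M.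

(** The inner integral is a Lipschitz function of the outer variable, so the rectangle rule applies
    twice. After normalisation each integration costs [2 * PI * L / M]. *)
Lemma L1norm_grid p : exists L, 0 <= L /\ forall M, (0 < M)%nat ->
  Rabs (L1norm p - grid_sum p M / INR M ^ 2) <= L / INR M.
Proof.
destruct (trig_eval_lipschitz p) as [L [L0 HL]].
assert (PI0 := PI_RGT_0).
exists (4 * PI * L); split; [nra|intros M M0].
assert (MR : 0 < INR M) by now apply lt_0_INR.
set (h := 2 * PI / INR M).
assert (h0 : 0 <= h) by (left; apply Rdiv_lt_0_compat; lra).
assert (Mh : INR M * h = 2 * PI) by (unfold h; field; lra).
set (F := fun t1 t2 => Cmod (trig_eval p t1 t2)).
assert (F2 : forall t1, lipschitz (F t1) L).
{ intros t1 x y; eapply Rle_trans; [apply Cmod_diff|].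
  eapply Rle_trans; [apply HL|]; rewrite Rminus_diag, Rabs_R0; lra. }
assert (F1 : forall x y t2, Rabs (F x t2 - F y t2) <= L * Rabs (x - y)).
{ intros x y t2; eapply Rle_trans; [apply Cmod_diff|].
  eapply Rle_trans; [apply HL|]; rewrite Rminus_diag, Rabs_R0; lra. }
set (H := fun t1 => RInt (F t1) 0 (2 * PI)).
assert (HH : lipschitz H (2 * PI * L)).
{ intros x y; unfold H.
  assert (ex := fun t => lipschitz_ex_RInt (F t) L 0 (2 * PI) L0 (F2 t)).
  replace (RInt (F x) 0 (2 * PI) - RInt (F y) 0 (2 * PI))
    with (RInt (fun t => minus (F x t) (F y t)) 0 (2 * PI))
    by (rewrite (@RInt_minus R_CompleteNormedModule); auto).
  replace (2 * PI * L * Rabs (x - y)) with ((2 * PI - 0) * (L * Rabs (x - y))) by ring.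
  apply abs_RInt_le_const; [lra| |intros; apply F1].
  apply (@ex_RInt_minus R_CompleteNormedModule); auto. }
assert (r1 := riemann_sum H (2 * PI * L) h M ltac:(nra) HH h0).
assert (r2 : forall i, Rabs (H (INR i * h) - h * nsum (fun j => F (INR i * h) (INR j * h)) M)
    <= INR M * (L * h ^ 2)).
{ intros i; unfold H; rewrite <- Mh; now apply riemann_sum. }
assert (r3 := nsum_diff_le _ _ _ M r2).
rewrite nsum_scal in r3.
rewrite Mh in r1.
fold (grid_sum p M) in r3.
assert (eq : L1norm p - grid_sum p M / INR M ^ 2
  = / (4 * PI ^ 2) * (RInt H 0 (2 * PI) - h * (h * grid_sum p M))).
{ unfold L1norm.
  change (fun t1 => RInt (fun t2 => Cmod (trig_eval p t1 t2)) 0 (2 * PI)) with H.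
  unfold h; field; split; lra. }
rewrite eq, Rabs_mult, Rabs_right;
  [|left; apply Rinv_0_lt_compat; nra].
replace (RInt H 0 (2 * PI) - h * (h * grid_sum p M))
  with ((RInt H 0 (2 * PI) - h * nsum (fun i => H (INR i * h)) M)
    + h * (nsum (fun i => H (INR i * h)) M - h * grid_sum p M)) by ring.
apply Rle_trans with (/ (4 * PI ^ 2) *
  (INR M * (2 * PI * L * h ^ 2) + h * (INR M * (INR M * (L * h ^ 2))))).
- apply Rmult_le_compat_l; [left; apply Rinv_0_lt_compat; nra|].
  eapply Rle_trans; [apply Rabs_triang|].
  apply Rplus_le_compat; auto.
  rewrite Rabs_mult, (Rabs_right h) by lra.
  now apply Rmult_le_compat_l.
- right; unfold h; field; split; lra.
Qed.

Lemma grid_cvg p eps : 0 < eps -> exists m, forall M, (m <= M)%nat -> (0 < M)%nat ->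
  Rabs (L1norm p - grid_sum p M / INR M ^ 2) <= eps.
Proof.
intros eps0; destruct (L1norm_grid p) as [L [L0 HL]].
destruct (archimed_cor1 (eps / (L + 1))) as [m [Hm m0]].
{ apply Rdiv_lt_0_compat; lra. }
exists m; intros M mM M0; eapply Rle_trans; [now apply HL|].
assert (mR : 0 < INR m) by now apply lt_0_INR.
assert (MR : 0 < INR M) by now apply lt_0_INR.
assert (i : / INR M <= / INR m) by (apply Rinv_le_contravar; auto; now apply le_INR).
assert (i0 : 0 < / INR M) by now apply Rinv_0_lt_compat.
assert (e : eps = (L + 1) * (eps / (L + 1))) by (field; lra).
rewrite e; unfold Rdiv at 1; nra.
Qed.

(** The grid estimates need [M] large and divisible by prescribed integers; since the grid sums
    converge, norms may be compared along any unbounded set of such [M]. *)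
Definition unbounded (P : nat -> Prop) := forall m, exists M, (m <= M)%nat /\ P M.

Lemma le_of_grid_le p q K P : 0 <= K -> unbounded P ->
  (forall M, (0 < M)%nat -> P M -> grid_sum q M <= K * grid_sum p M) ->
  L1norm q <= K * L1norm p.
Proof.
intros K0 HP H; apply le_epsilon; intros eps eps0.
(* The error of [q] counts once, that of [p] is multiplied by [K]. *)
assert (e0 : 0 < eps / (1 + K)) by (apply Rdiv_lt_0_compat; lra).
destruct (grid_cvg p _ e0) as [mp Hp]; destruct (grid_cvg q _ e0) as [mq Hq].
destruct (HP (S (mp + mq))) as [M [mM PM]].
specialize (Hp M ltac:(lia) ltac:(lia)); specialize (Hq M ltac:(lia) ltac:(lia)).
assert (MR : 0 < INR M) by (apply lt_0_INR; lia).
assert (g := H M ltac:(lia) PM).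
assert (g' : grid_sum q M / INR M ^ 2 <= K * (grid_sum p M / INR M ^ 2)).
{ unfold Rdiv; rewrite <- Rmult_assoc; apply Rmult_le_compat_r; auto.
  left; apply Rinv_0_lt_compat; nra. }
apply Rabs_le_between in Hp; apply Rabs_le_between in Hq.
assert (K * (grid_sum p M / INR M ^ 2) <= K * (L1norm p + eps / (1 + K)))
  by (apply Rmult_le_compat_l; lra).
assert (eps = eps / (1 + K) + K * (eps / (1 + K))) by (field; lra).
lra.
Qed.

Lemma L1norm_le_grid p B P : unbounded P ->
  (forall M, (0 < M)%nat -> P M -> grid_sum p M <= INR M ^ 2 * B) -> L1norm p <= B.
Proof.
intros HP H; apply le_epsilon; intros eps eps0.
destruct (grid_cvg p _ eps0) as [m Hp]; destruct (HP (S m)) as [M [mM PM]].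
specialize (Hp M ltac:(lia) ltac:(lia)); specialize (H M ltac:(lia) PM).
assert (MR : 0 < INR M) by (apply lt_0_INR; lia).
apply Rabs_le_between in Hp.
assert (grid_sum p M / INR M ^ 2 <= B); [|lra].
apply Rmult_le_reg_r with (INR M ^ 2); [nra|].
unfold Rdiv; rewrite Rmult_assoc, Rinv_l; nra.
Qed.

Lemma L1norm_ge_grid p B P : unbounded P ->
  (forall M, (0 < M)%nat -> P M -> INR M ^ 2 * B <= grid_sum p M) -> B <= L1norm p.
Proof.
intros HP H; apply le_epsilon; intros eps eps0.
destruct (grid_cvg p _ eps0) as [m Hp]; destruct (HP (S m)) as [M [mM PM]].
specialize (Hp M ltac:(lia) ltac:(lia)); specialize (H M ltac:(lia) PM).
assert (MR : 0 < INR M) by (apply lt_0_INR; lia).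
apply Rabs_le_between in Hp.
assert (B <= grid_sum p M / INR M ^ 2); [|lra].
apply Rmult_le_reg_r with (INR M ^ 2); [nra|].
unfold Rdiv; rewrite Rmult_assoc, Rinv_l; nra.
Qed.

Lemma nsum_ge0 f n : (forall i, 0 <= f i) -> 0 <= nsum f n.
Proof. intros H; induction n as [|n IH]; simpl; [lra|specialize (H n); lra]. Qed.

Lemma L1norm_ge0 p : 0 <= L1norm p.
Proof.
apply (L1norm_ge_grid p 0 (fun _ => True)).
- intros m; exists m; auto.
- intros M _ _; rewrite Rmult_0_r; apply nsum_ge0; intros i; apply nsum_ge0; intros j.
  apply Cmod_ge_0.
Qed.

(** * Growth of the two sequences *)

Lemma lacunary_S d : lacunary d -> forall k, (d k < d (S k))%nat.
Proof.
intros [d0 [q [q1 H]]] k; apply INR_lt; specialize (H k).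
assert (0 < INR (d k)) by now apply lt_0_INR.
nra.
Qed.

(** A proper multiple is at least the double. Positivity comes from strict growth, as 0 divides only
    0. *)
Lemma divide_chain_double N : (forall k, Nat.divide (N k) (N (S k))) ->
  (forall k, (N k < N (S k))%nat) ->
  forall k, (0 < N k)%nat /\ (2 * N k <= N (S k))%nat.
Proof.
intros Hd Hl k; destruct (Hd k) as [z Hz]; specialize (Hl k).
split; [destruct (N k); lia|].
destruct z as [|[|z]]; nia.
Qed.

Lemma doubling_iter N : (forall k, (2 * N k <= N (S k))%nat) ->
  forall b k, (2 ^ b * N k <= N (k + b))%nat.
Proof.
intros H b k; induction b as [|b IH].
- rewrite Nat.add_0_r; simpl; lia.
- rewrite Nat.add_succ_r; specialize (H (k + b)%nat); simpl; lia.
Qed.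

Lemma lacunary_iter d q : 1 < q -> (forall k, q * INR (d k) <= INR (d (S k))) ->
  forall b k, q ^ b * INR (d k) <= INR (d (k + b)%nat).
Proof.
intros q1 H b k; induction b as [|b IH].
- rewrite Nat.add_0_r; simpl; lra.
- rewrite Nat.add_succ_r; eapply Rle_trans; [|apply H]; simpl.
  rewrite Rmult_assoc; apply Rmult_le_compat_l; lra.
Qed.

(** Along each residue class modulo [s] the growth condition holds with constant 1 and shift 1, and
    the ratios of [d] exceed 2, as the proof of Paley's inequality demands. *)
Lemma stride_exists d N a C : lacunary d -> (forall k, (2 * N k <= N (S k))%nat) ->
  (forall k, INR (d k) <= C * INR (N (k + a)%nat)) ->
  exists s, (0 < s)%nat /\ (forall k, (d k <= N (k + s))%nat) /\
    (forall k, (2 * d k < d (k + s))%nat).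
Proof.
intros [d0 [q [q1 Hq]]] HN H.
destruct (INR_unbounded C) as [b Hb].
destruct (INR_unbounded (2 / (q - 1))) as [c Hc].
(* [b] extra doublings of [N] absorb [C], and [c] factors [q] exceed 2 by Bernoulli's inequality. *)
exists (a + b + c + 1)%nat; split; [lia|split; intros k].
- apply INR_le; eapply Rle_trans; [apply H|].
  assert (h := doubling_iter N HN (b + c + 1) (k + a)).
  replace (k + a + (b + c + 1))%nat with (k + (a + b + c + 1))%nat in h by lia.
  apply le_INR in h; eapply Rle_trans; [|exact h].
  rewrite mult_INR; apply Rmult_le_compat_r; [apply pos_INR|].
  apply Rle_trans with (INR b); [lra|apply le_INR].
  assert (h2 := Nat.pow_gt_lin_r 2 (b + c + 1) ltac:(lia)); lia.
- apply INR_lt; rewrite mult_INR.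
  eapply Rlt_le_trans; [|apply (lacunary_iter d q q1 Hq)].
  apply Rmult_lt_compat_r; [now apply lt_0_INR|].
  assert (h := poly (a + b + c + 1) (q - 1) ltac:(lra)).
  replace (1 + (q - 1)) with q in h by ring.
  assert (INR c <= INR (a + b + c + 1)) by (apply le_INR; lia).
  assert (2 < INR c * (q - 1)).
  { apply Rmult_lt_reg_r with (/ (q - 1)); [apply Rinv_0_lt_compat; lra|].
    rewrite Rmult_assoc, Rinv_r, Rmult_1_r; lra. }
  simpl (INR 2); nra.
Qed.

(** * Chord lengths on the circle *)

(** Otherwise [cos (7 / 4)] would be positive, against its Taylor bound of degree four. This is the
    source of the factor 7 in [chord_upper]. *)
Lemma PI_le : PI <= 7 / 2.
Proof.
destruct (Rle_or_lt PI (7 / 2)) as [|h]; auto; exfalso.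
assert (c := cos_gt_0 (7 / 4) ltac:(lra) ltac:(lra)).
destruct (pre_cos_bound (7 / 4) 0 ltac:(lra) ltac:(lra)) as [_ u].
unfold cos_approx, cos_term in u; simpl in u; lra.
Qed.

(** The cubic Taylor bound [x - x^3 / 6] with [x <= 2]. *)
Lemma sin_ge x : 0 <= x -> x <= PI / 2 -> x / 3 <= sin x.
Proof.
intros x0 x1; assert (p := PI_4).
destruct (pre_sin_bound x 0 x0 ltac:(lra)) as [l _].
unfold sin_approx, sin_term in l; simpl in l.
assert (x * x <= 4) by nra.
assert (x * (x * x) <= x * 4) by (apply Rmult_le_compat_l; lra).
lra.
Qed.

(** Both sides are the squared distance from [exp(i t)] to 1. *)
Lemma chord_sqr t : (cos t - 1) ^ 2 + sin t ^ 2 = (2 * sin (t / 2)) ^ 2.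
Proof.
assert (e : cos t = 1 - 2 * sin (t / 2) * sin (t / 2)).
{ rewrite <- cos_2a_sin; f_equal; field. }
assert (h := sin2_cos2 t); unfold Rsqr in h.
replace (sin t ^ 2) with (1 - cos t * cos t) by nra.
rewrite e; ring.
Qed.

Lemma chord_upper M r : (0 < M)%nat -> (r <= M)%nat ->
  Rabs (2 * sin (INR r * (2 * PI / INR M) / 2)) <= 7 * INR r / INR M.
Proof.
intros M0 rM; assert (MR : 0 < INR M) by now apply lt_0_INR.
assert (rR := pos_INR r); assert (P0 := PI_RGT_0); assert (P7 := PI_le).
assert (iM : 0 < / INR M) by now apply Rinv_0_lt_compat.
set (x := INR r * (2 * PI / INR M) / 2).
assert (xe : x = PI * (INR r * / INR M)) by (unfold x; field; lra).
assert (q0 : 0 <= INR r * / INR M) by nra.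
assert (s := sin_lipschitz x 0); rewrite sin_0, !Rminus_0_r in s.
rewrite (Rabs_right x) in s by nra.
rewrite Rabs_mult, (Rabs_right 2) by lra.
unfold Rdiv; rewrite Rmult_assoc; nra.
Qed.

(** The reflection [x |-> PI - x] reduces to the shorter arc, where [sin_ge] applies. *)
Lemma chord_lower M r : (0 < M)%nat -> (r <= M)%nat ->
  INR (Nat.min r (M - r)) / INR M <= Rabs (2 * sin (INR r * (2 * PI / INR M) / 2)).
Proof.
intros M0 rM; assert (MR : 0 < INR M) by now apply lt_0_INR.
assert (P0 := PI_RGT_0); assert (P3 := PI2_3_2).
assert (key : forall m, (2 * m <= M)%nat ->
  INR m / INR M <= 2 * sin (PI * (INR m / INR M))).
{ intros m hm; assert (mR := pos_INR m).
  assert (q : INR m / INR M <= 1 / 2).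
  { apply Rmult_le_reg_r with (INR M); auto.
    unfold Rdiv; rewrite Rmult_assoc, Rinv_l by lra.
    apply le_INR in hm; rewrite mult_INR in hm; simpl in hm; lra. }
  assert (q0 : 0 <= INR m / INR M) by (apply Rdiv_le_0_compat; lra).
  assert (s := sin_ge (PI * (INR m / INR M)) ltac:(nra) ltac:(nra)).
  nra. }
eapply Rle_trans; [|apply Rle_abs].
replace (INR r * (2 * PI / INR M) / 2) with (PI * (INR r / INR M)) by (field; lra).
destruct (Nat.le_ge_cases (2 * r) M) as [h|h].
- rewrite Nat.min_l by lia; now apply key.
- rewrite Nat.min_r by lia.
  replace (sin (PI * (INR r / INR M))) with (sin (PI * (INR (M - r) / INR M))).
  + apply key; lia.
  + rewrite minus_INR by lia.
    replace (PI * ((INR M - INR r) / INR M)) with (PI - PI * (INR r / INR M)) by (field; lra).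
    apply sin_PI_x.
Qed.

Module GridEstimates.

From mathcomp Require Import all_boot all_order all_algebra complex Rstruct ring lra zify.
Set Implicit Arguments.
Unset Strict Implicit.
Unset Printing Implicit Defensive.
Import Order.TTheory GRing.Theory Num.Theory.
Local Open Scope nat_scope.
Local Open Scope ring_scope.
Local Open Scope complex_scope.

(** * Moduli and square functions *)

Section Modulus.
Variable R : rcfType.
Implicit Types (z : R[i]) (x : R).

Definition nm z : R := Num.sqrt (complex.Re z ^+ 2 + complex.Im z ^+ 2).

(* A copy of [conjc] fixed at one ring structure, since [z^*] is elaborated either as
   [conjc] or as [Num.conj] depending on the context. *)
Definition cj z : R[i] := complex.Re z -i* complex.Im z.

Lemma cjK z : cj (cj z) = z.
Proof. by case: z => a b; rewrite /cj /= opprK. Qed.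

Lemma cjD z1 z2 : cj (z1 + z2) = cj z1 + cj z2.
Proof. by case: z1 z2 => [a b] [c d]; apply/eqP; rewrite eq_complex /= eqxx /= opprD. Qed.

Lemma cjM z1 z2 : cj (z1 * z2) = cj z1 * cj z2.
Proof.
case: z1 z2 => [a b] [c d]; apply/eqP; rewrite eq_complex /=.
by apply/andP; split; apply/eqP; ring.
Qed.

Lemma cjR x : cj x%:C = x%:C.
Proof. by rewrite /cj /= oppr0. Qed.

Lemma cjX z n : cj (z ^+ n) = cj z ^+ n.
Proof. by elim: n => [|n IH]; rewrite ?expr0 ?(cjR 1) // !exprS cjM IH. Qed.

Lemma cj_sum (I : Type) (r : seq I) (P : pred I) (F : I -> R[i]) :
  cj (\sum_(i <- r | P i) F i) = \sum_(i <- r | P i) cj (F i).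
Proof. exact: (big_morph cj cjD (cjR 0)). Qed.

Lemma nmE z : nm z = Normc.normc z. Proof. by case: z. Qed.

Lemma nm_ge0 z : 0 <= nm z. Proof. exact: sqrtr_ge0. Qed.

Lemma sqr_nm z : nm z ^+ 2 = complex.Re z ^+ 2 + complex.Im z ^+ 2.
Proof. by rewrite sqr_sqrtr // addr_ge0 // sqr_ge0. Qed.

Lemma nmM z1 z2 : nm (z1 * z2) = nm z1 * nm z2.
Proof. by rewrite !nmE Normc.normcM. Qed.

Lemma nmD z1 z2 : nm (z1 + z2) <= nm z1 + nm z2.
Proof. by rewrite !nmE; exact: le_normcD. Qed.

Lemma nm0_eq0 z : (nm z == 0) = (z == 0).
Proof.
by rewrite nmE; apply/eqP/eqP => [/Normc.eq0_normc|->] //; rewrite Normc.normc0.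
Qed.

Lemma nmN z : nm (- z) = nm z.
Proof. by rewrite /nm !raddfN /= !sqrrN. Qed.

Lemma nmB z1 z2 : nm (z1 - z2) = nm (z2 - z1).
Proof. by rewrite -nmN opprB. Qed.

Lemma nm_cj z : nm (cj z) = nm z.
Proof. by case: z => a b; rewrite /nm /= sqrrN. Qed.

Lemma nmR x : nm x%:C = `|x|.
Proof. by rewrite /nm /= expr0n /= addr0 sqrtr_sqr. Qed.

Lemma nm0 : nm 0 = 0. Proof. by rewrite (nmR 0) normr0. Qed.
Lemma nm_nat n : nm n%:R = n%:R.
Proof. by rewrite -(rmorph_nat (real_complex R)) nmR ger0_norm ?ler0n. Qed.
Lemma nm1 : nm 1 = 1. Proof. by rewrite (nmR 1) normr1. Qed.

Lemma nmX z n : nm (z ^+ n) = nm z ^+ n.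
Proof. by elim: n => [|n IH]; rewrite ?expr0 ?nm1 // !exprS nmM IH. Qed.

Lemma nm_sum (I : Type) (r : seq I) (P : pred I) (F : I -> R[i]) :
  nm (\sum_(i <- r | P i) F i) <= \sum_(i <- r | P i) nm (F i).
Proof.
elim/big_rec2: _ => [|i x z _ H]; first by rewrite nm0.
by apply: le_trans (nmD _ _) _; rewrite lerD2l.
Qed.

Lemma mul_cj z : z * cj z = (nm z ^+ 2)%:C.
Proof.
case: z => a b; rewrite sqr_nm /=; apply/eqP; rewrite eq_complex /=.
by apply/andP; split; apply/eqP; ring.
Qed.

Lemma Re_le_nm z : complex.Re z <= nm z.
Proof.
apply: le_trans (ler_norm _) _; rewrite -sqrtr_sqr ler_wsqrtr //.
by rewrite lerDl sqr_ge0.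
Qed.

End Modulus.

(** * Euclidean norms of initial segments and their increments *)

Section Euclid.
Variable R : rcfType.

Lemma sqrt_le_sqr (x y : R) : 0 <= y -> x <= y ^+ 2 -> Num.sqrt x <= y.
Proof. by move=> y0 h; rewrite (le_trans (ler_wsqrtr h)) // sqrtr_sqr ger0_norm. Qed.

(** The length is a separate argument, so that the initial segments of one sequence serve as its
    past. *)
Definition l2 n (x : nat -> R) := Num.sqrt (\sum_(k < n) x k ^+ 2).

Lemma l2_ge0 n x : 0 <= l2 n x. Proof. exact: sqrtr_ge0. Qed.

Lemma sqr_l2 n x : l2 n x ^+ 2 = \sum_(k < n) x k ^+ 2.
Proof. by rewrite sqr_sqrtr // sumr_ge0 // => i _; exact: sqr_ge0. Qed.

Lemma l2_0 x : l2 0 x = 0. Proof. by rewrite /l2 big_ord0 sqrtr0. Qed.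

Lemma l2S n x : l2 n.+1 x = Num.sqrt (l2 n x ^+ 2 + x n ^+ 2).
Proof. by rewrite sqr_l2 /l2 big_ord_recr. Qed.

Lemma l2_le n (x y : nat -> R) :
  (forall k, (k < n)%N -> `|x k| <= `|y k|) -> l2 n x <= l2 n y.
Proof.
move=> h; apply: ler_wsqrtr; apply: ler_sum => i _.
by rewrite -(real_normK (num_real (x i))) -(real_normK (num_real (y i)))
  lerXn2r ?nnegrE ?normr_ge0 ?h.
Qed.

Lemma l2Z n (c : R) (x : nat -> R) : 0 <= c -> l2 n (fun k => c * x k) = c * l2 n x.
Proof.
move=> c0; rewrite /l2 (eq_bigr (fun k : 'I_n => c ^+ 2 * x k ^+ 2)).
  by rewrite -mulr_sumr sqrtrM ?sqr_ge0 // sqrtr_sqr ger0_norm.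
by move=> i _; rewrite exprMn.
Qed.

Lemma l2_ge_term n (x : nat -> R) k : (k < n)%N -> x k <= l2 n x.
Proof.
move=> kn; apply: le_trans (ler_norm _) _; rewrite -sqrtr_sqr; apply: ler_wsqrtr.
by rewrite (bigD1 (Ordinal kn)) //= lerDl sumr_ge0 // => i _; exact: sqr_ge0.
Qed.

Lemma planar_triangle (a b c d : R) :
  Num.sqrt ((a + b) ^+ 2 + (c + d) ^+ 2)
    <= Num.sqrt (a ^+ 2 + c ^+ 2) + Num.sqrt (b ^+ 2 + d ^+ 2).
Proof. exact: (nmD (a +i* c) (b +i* d)). Qed.

Lemma l2D n (x y : nat -> R) : l2 n (fun k => x k + y k) <= l2 n x + l2 n y.
Proof.
elim: n => [|n IH]; first by rewrite !l2_0 addr0.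
rewrite !l2S; apply: le_trans (planar_triangle _ _ _ _).
apply: ler_wsqrtr; rewrite lerD2r lerXn2r ?nnegrE ?addr_ge0 ?l2_ge0 //.
Qed.

Lemma l2_sum n (I : Type) (r : seq I) (P : pred I) (F : I -> nat -> R) :
  l2 n (fun k => \sum_(i <- r | P i) F i k) <= \sum_(i <- r | P i) l2 n (F i).
Proof.
elim: r => [|i r IH].
  rewrite !big_nil /l2 big1 ?sqrtr0 // => k _; by rewrite big_nil expr0n.
rewrite big_cons; case: ifP => Pi; last first.
  apply: le_trans IH; apply: l2_le => k _; by rewrite big_cons Pi.
apply: le_trans (lerD (lexx _) IH); apply: le_trans (l2D _ _ _).
by apply: l2_le => k _; rewrite big_cons Pi.
Qed.

Lemma l2_le_l1 n (x : nat -> R) : (forall k, 0 <= x k) -> l2 n x <= \sum_(k < n) x k.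
Proof.
move=> x0; elim: n => [|n IH]; first by rewrite l2_0 big_ord0.
rewrite l2S big_ord_recr /=; apply: le_trans (lerD IH (lexx _)).
apply: sqrt_le_sqr; first by rewrite addr_ge0 ?l2_ge0.
have := l2_ge0 n x; have := x0 n; nra.
Qed.

(** Cauchy-Schwarz against the constant vector, from [x i * x j <= (x i ^ 2 + x j ^ 2) / 2]. *)
Lemma sum_le_sqrt n (x : 'I_n -> R) : (forall k, 0 <= x k) ->
  \sum_k x k <= Num.sqrt n%:R * Num.sqrt (\sum_k x k ^+ 2).
Proof.
move=> x0; rewrite -sqrtrM ?ler0n //.
have s0 : 0 <= \sum_k x k by apply: sumr_ge0.
rewrite -[leLHS]ger0_norm // -sqrtr_sqr; apply: ler_wsqrtr.
rewrite expr2 mulr_suml.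
have -> : \sum_i x i * \sum_j x j = \sum_i \sum_j x i * x j.
  by apply: eq_bigr => i _; rewrite mulr_sumr.
apply: (@le_trans _ _ (\sum_i \sum_j ((x i ^+ 2 + x j ^+ 2) / 2%:R))).
  apply: ler_sum => i _; apply: ler_sum => j _.
  have := sqr_ge0 (x i - x j); lra.
under eq_bigr do rewrite -mulr_suml big_split /= sumr_const card_ord.
rewrite -mulr_suml big_split /= sumr_const card_ord sumrMnl mulr_natl.
by set t := _ *+ n; lra.
Qed.

(* The increment of the square function when the coordinate x is appended to a
   vector of length a. *)
Definition Phi (a x : R) := Num.sqrt (a ^+ 2 + x ^+ 2) - a.

Lemma sqrtD_ge (a x : R) : 0 <= a -> a <= Num.sqrt (a ^+ 2 + x ^+ 2).
Proof.
move=> a0; rewrite -{1}(ger0_norm a0) -sqrtr_sqr ler_wsqrtr //.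
by rewrite lerDl sqr_ge0.
Qed.

Lemma Phi_ge0 a x : 0 <= a -> 0 <= Phi a x.
Proof. by move=> a0; rewrite subr_ge0 sqrtD_ge. Qed.

(** Rationalised form of the increment, stated as a product so that [a = x = 0] needs no
    exception. *)
Lemma Phi_factor a x : Phi a x * (Num.sqrt (a ^+ 2 + x ^+ 2) + a) = x ^+ 2.
Proof.
rewrite /Phi -subr_sqr sqr_sqrtr ?addr_ge0 ?sqr_ge0 //; ring.
Qed.

(** In the rationalised form the numerators agree and the denominators compare up to [lam]. Every
    replacement of one past by a comparable one goes through this bound. *)
Lemma Phi_scale (lam a b x : R) : 1 <= lam -> 0 <= a -> 0 <= b -> a <= lam * b ->
  Phi b x <= lam * Phi a x.
Proof.
move=> l1 a0 b0 ab.
have fa := Phi_factor a x; have fb := Phi_factor b x.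
have pa := Phi_ge0 x a0; have pb := Phi_ge0 x b0.
set T := Num.sqrt (a ^+ 2 + x ^+ 2) in fa.
set S := Num.sqrt (b ^+ 2 + x ^+ 2) in fb.
have S0 : 0 <= S := sqrtr_ge0 _.
have TS : T <= lam * S.
  apply: sqrt_le_sqr; first by rewrite mulr_ge0 // (le_trans _ l1).
  rewrite exprMn sqr_sqrtr ?addr_ge0 ?sqr_ge0 // mulrDr -exprMn.
  rewrite lerD //; first by rewrite lerXn2r ?nnegrE // mulr_ge0 // (le_trans _ l1).
  by rewrite ler_peMl ?sqr_ge0 // exprn_ege1.
case: (ltP 0 (S + b)) => [Sb|Sb]; last first.
  (* A zero denominator forces [x = 0], and then the increment vanishes. *)
  have Sb0 : S + b = 0 by lra.
  have x0 : x ^+ 2 = 0 by rewrite -fb Sb0 mulr0.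
  have -> : Phi b x = 0 by rewrite /Phi x0 addr0 sqrtr_sqr ger0_norm // subrr.
  by rewrite mulr_ge0 // (le_trans _ l1).
rewrite -(ler_pM2r Sb) fb -fa -mulrA [lam * _]mulrC -mulrA ler_wpM2l //.
by nra.
Qed.

Lemma Phi_anti (a b x : R) : 0 <= a -> a <= b -> Phi b x <= Phi a x.
Proof.
by move=> a0 ab; rewrite -[leRHS]mul1r Phi_scale // ?mul1r // (le_trans a0).
Qed.

(* By homogeneity the weights need not add up to 1. *)
Lemma Phi_convex (I : finType) (p a x : I -> R) : (forall i, 0 <= p i) ->
  Phi (\sum_i p i * a i) (\sum_i p i * x i) <= \sum_i p i * Phi (a i) (x i).
Proof.
move=> p0; rewrite /Phi.
under [leRHS]eq_bigr do rewrite mulrBr.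
rewrite sumrB lerD2r.
(* Minkowski's inequality in the plane: the triangle inequality for the vectors
   [p i * (a i, x i)]. *)
have := nm_sum (index_enum I) predT (fun i => (p i)%:C * (a i +i* x i)).
have -> : \sum_i (p i)%:C * (a i +i* x i)
   = (\sum_i p i * a i) +i* (\sum_i p i * x i).
  elim/big_rec3: _ => [|i u v w _ ->] //.
  by apply/eqP; rewrite eq_complex /= !mul0r !addr0 !subr0 !eqxx.
move=> h; apply: le_trans h _; apply: ler_sum => i _.
by rewrite nmM nmR ger0_norm.
Qed.

Lemma l2_telescope n (x : nat -> R) : l2 n x = \sum_(k < n) Phi (l2 k x) (x k).
Proof.
elim: n => [|n IH]; first by rewrite l2_0 big_ord0.
by rewrite big_ord_recr /= -IH /Phi -l2S addrC subrK.
Qed.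

Lemma Phi_subadd (a b x y : R) : 0 <= a -> a <= b ->
  Num.sqrt (b ^+ 2 + (x ^+ 2 + y ^+ 2)) <= b + Phi a x + Phi a y.
Proof.
move=> a0 ab; have b0 : 0 <= b by apply: le_trans ab.
apply: (@le_trans _ _ (b + Phi b x + Phi b y)); last first.
  by apply: lerD; [rewrite lerD2l|]; exact: Phi_anti.
have px := Phi_ge0 x b0; have py := Phi_ge0 y b0.
apply: sqrt_le_sqr; first by lra.
have fx := Phi_factor b x; have fy := Phi_factor b y.
have ex : Num.sqrt (b ^+ 2 + x ^+ 2) = Phi b x + b by rewrite /Phi subrK.
have ey : Num.sqrt (b ^+ 2 + y ^+ 2) = Phi b y + b by rewrite /Phi subrK.
(* With [p] and [q] the increments, [x^2 = p (p + 2 b)] and [y^2 = q (q + 2 b)], and the squares of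
   the two sides differ by [2 p q]. *)
rewrite ex in fx; rewrite ey in fy; rewrite -fx -fy; nra.
Qed.

(** Adjoining both [w k] and [G k] at step [k] gives a past that dominates [l2 k G], and increments
    decrease in the past. The past of [w] itself disappears from the bound, which is what permits a
    tangent sequence. *)
Lemma l2_le_Phi n (w G : nat -> R) :
  l2 n w <= \sum_(k < n) (Phi (l2 k G) (w k) + Phi (l2 k G) (G k)).
Proof.
pose B n := Num.sqrt (\sum_(k < n) (w k ^+ 2 + G k ^+ 2)).
have s0 m : 0 <= \sum_(k < m) (w k ^+ 2 + G k ^+ 2).
  by apply: sumr_ge0 => i _; rewrite addr_ge0 ?sqr_ge0.
have GB m : l2 m G <= B m.
  by apply: ler_wsqrtr; apply: ler_sum => i _; rewrite lerDr sqr_ge0.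
have wB : l2 n w <= B n.
  by apply: ler_wsqrtr; apply: ler_sum => i _; rewrite lerDl sqr_ge0.
apply: le_trans wB _; elim: n => [|n IH]; first by rewrite /B !big_ord0 sqrtr0.
rewrite big_ord_recr /= addrA; apply: le_trans (lerD (lerD IH (lexx _)) (lexx _)).
rewrite /B big_ord_recr /= -[X in Num.sqrt (X + _)](sqr_sqrtr (s0 _)).
by apply: Phi_subadd; rewrite ?l2_ge0 ?GB.
Qed.
End Euclid.

(** * Sums over roots of unity and Paley's inequality *)

(* A bound on the number of frequencies of the test functions [psi] below. *)
Fixpoint psi_size (d : nat -> nat) k :=
  if k is k'.+1 then (2 * psi_size d k' + 2 * d k' + 1)%N else 1%N.

Lemma psi_size_mono d j k : (j <= k)%N -> (psi_size d j <= psi_size d k)%N.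
Proof.
by move/subnKC <-; elim: (k - j)%N => [|i IH]; rewrite ?addn0 // addnS /=; lia.
Qed.

Section Grid.
Variables (R : rcfType) (M : nat) (w : R[i]).
Hypothesis M_gt0 : (0 < M)%N.
Hypothesis w_prim : M.-primitive_root w.

Lemma nm_w : nm w = 1.
Proof.
have := congr1 (@nm R) (prim_expr_order w_prim); rewrite nmX nm1 => /eqP.
by rewrite pexpr_eq1 ?nm_ge0 // => /eqP.
Qed.

Lemma nm_grid s : nm (w ^+ s) = 1.
Proof. by rewrite nmX nm_w expr1n. Qed.

Lemma nm_gridX s n : nm ((w ^+ s) ^+ n) = 1.
Proof. by rewrite nmX nm_grid expr1n. Qed.

Lemma gridJ s : w ^+ s * cj (w ^+ s) = 1.
Proof. by rewrite mul_cj nm_grid expr1n. Qed.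

Lemma gridXJ s n : (w ^+ s) ^+ n * cj ((w ^+ s) ^+ n) = 1.
Proof. by rewrite mul_cj nm_gridX expr1n. Qed.

Lemma sum_grid n :
  \sum_(s < M) (w ^+ s) ^+ n = if (M %| n)%N then M%:R else 0 :> R[i].
Proof.
under eq_bigr do rewrite exprAC.
case: ifP => Mn.
  have -> : w ^+ n = 1 by apply/eqP; rewrite -(prim_order_dvd w_prim).
  under eq_bigr do rewrite expr1n.
  by rewrite sumr_const card_ord.
have zn1 : w ^+ n - 1 != 0 by rewrite subr_eq0 -(prim_order_dvd w_prim) Mn.
apply: (mulfI zn1); rewrite mulr0 -subrX1 exprAC.
by rewrite (prim_expr_order w_prim) expr1n subrr.
Qed.

Lemma sum_gridJ a b : (a < M)%N -> (b < M)%N ->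
  \sum_(s < M) (w ^+ s) ^+ a * cj ((w ^+ s) ^+ b) = if a == b then M%:R else 0 :> R[i].
Proof.
move=> aM bM.
have -> : \sum_(s < M) (w ^+ s) ^+ a * cj ((w ^+ s) ^+ b)
    = \sum_(s < M) (w ^+ s) ^+ (a + (M - b)) :> R[i].
  apply: eq_bigr => s _; rewrite exprD; congr (_ * _).
  apply: (mulfI (x := (w ^+ s) ^+ b)).
    by rewrite expf_neq0 // expf_neq0 // -nm0_eq0 nm_w oner_eq0.
  rewrite gridXJ -exprD; have -> : (b + (M - b) = M)%N by lia.
  by rewrite -exprM mulnC exprM (prim_expr_order w_prim) expr1n.
rewrite sum_grid; congr (if _ then _ else _).
apply/idP/eqP => [/dvdnP[q e]|->]; last by rewrite subnKC // ltnW.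
have : q = 1%N by nia.
by move=> q1; lia.
Qed.

Lemma sum_grid_rot (T : nmodType) (f : R[i] -> T) s :
  \sum_(u < M) f (w ^+ u * w ^+ s) = \sum_(u < M) f (w ^+ u).
Proof.
pose h (u : 'I_M) := Ordinal (ltn_pmod (u + s) M_gt0).
have h_inj : injective h.
  move=> u v /(congr1 val) /= /eqP; rewrite eqn_modDr !modn_small ?ltn_ord //.
  by move/eqP/val_inj.
rewrite [RHS](reindex_inj h_inj) /=; apply: eq_bigr => u _.
by rewrite (prim_expr_mod w_prim) exprD.
Qed.

Lemma sum_grid2 (T : nmodType) (f : R[i] -> R[i] -> T) :
  \sum_(x < M) \sum_(y < M) f (w ^+ x) (w ^+ y)
    = \sum_(u < M) \sum_(s < M) f (w ^+ u * w ^+ s) (w ^+ s).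
Proof.
rewrite exchange_big [RHS]exchange_big; apply: eq_bigr => s _ /=.
by rewrite (sum_grid_rot (fun z => f z (w ^+ s))).
Qed.

(** The exponents present lie strictly between 0 and [M], so none aliases to 0 on the grid. *)
Lemma mean_shift (Q : {poly R[i]}) m : (0 < m)%N -> (size Q + m <= M)%N ->
  \sum_(s < M) (w ^+ s) ^+ m * Q.[w ^+ s] = 0.
Proof.
move=> m0 mM.
under eq_bigr do rewrite horner_coef mulr_sumr.
rewrite exchange_big big1 // => i _.
under eq_bigr do rewrite mulrCA -exprD.
rewrite -mulr_sumr sum_grid gtnNdvd ?mulr0 //; first by rewrite addn_gt0 m0.
have := ltn_ord i; lia.
Qed.

Lemma mean_coef (P : {poly R[i]}) d : (size P <= M)%N -> (d < M)%N ->
  \sum_(s < M) P.[w ^+ s] * cj ((w ^+ s) ^+ d) = M%:R * P`_d.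
Proof.
move=> PM dM.
under eq_bigr do rewrite (horner_coef_wide _ PM) mulr_suml.
rewrite exchange_big (bigD1 (Ordinal dM)) //= [X in _ + X]big1 => [|i ne].
  under eq_bigr do rewrite -mulrA.
  by rewrite -mulr_sumr sum_gridJ // eqxx addr0 mulrC.
under eq_bigr do rewrite -mulrA.
rewrite -mulr_sumr sum_gridJ //.
case: eqP => [e|_]; last by rewrite mulr0.
by move: ne; rewrite -val_eqE /= e eqxx.
Qed.

Lemma parseval n (d : nat -> nat) (h : nat -> R[i]) :
  {in gtn n &, injective d} -> (forall k, (k < n)%N -> (d k < M)%N) ->
  \sum_(s < M) nm (\sum_(k < n) (w ^+ s) ^+ d k * h k) ^+ 2
    = M%:R * \sum_(k < n) nm (h k) ^+ 2.
Proof.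
move=> d_inj dM; apply: complexI; rewrite rmorphM rmorph_nat !rmorph_sum /=.
under eq_bigr do rewrite -mul_cj cj_sum mulr_suml.
rewrite exchange_big mulr_sumr; apply: eq_bigr => k _.
under eq_bigr do rewrite mulr_sumr.
rewrite exchange_big (bigD1 k) //= [X in _ + X]big1 => [|j ne].
  under eq_bigr do rewrite cjM mulrACA.
  by rewrite -mulr_suml sum_gridJ ?dM // eqxx addr0 mul_cj.
under eq_bigr do rewrite cjM mulrACA.
rewrite -mulr_suml sum_gridJ ?dM //; case: eqP => [e|_]; last by rewrite mul0r.
by move: ne; rewrite -val_eqE /= (d_inj k j) ?eqxx //; rewrite inE.
Qed.

(** Cauchy-Schwarz in [s], then Parseval. *)
Lemma lacunary_sum_le n (d : nat -> nat) (h : nat -> R[i]) :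
  {in gtn n &, injective d} -> (forall k, (k < n)%N -> (d k < M)%N) ->
  \sum_(s < M) nm (\sum_(k < n) (w ^+ s) ^+ d k * h k)
    <= M%:R * l2 n (fun k => nm (h k)).
Proof.
move=> d_inj dM.
apply: le_trans (sum_le_sqrt _) _; first by move=> s; exact: nm_ge0.
by rewrite parseval // sqrtrM ?ler0n // mulrA -expr2 sqr_sqrtr ?ler0n.
Qed.

(** Pairing with the single character of frequency [d k] isolates [h k]. *)
Lemma lacunary_sum_ge n (d : nat -> nat) (h : nat -> R[i]) k :
  {in gtn n &, injective d} -> (forall k, (k < n)%N -> (d k < M)%N) -> (k < n)%N ->
  M%:R * nm (h k) <= \sum_(s < M) nm (\sum_(k < n) (w ^+ s) ^+ d k * h k).
Proof.
move=> d_inj dM kn.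
have -> : M%:R * nm (h k) = nm (\sum_(s < M)
    (\sum_(k < n) (w ^+ s) ^+ d k * h k) * cj ((w ^+ s) ^+ d k)).
  under eq_bigr do rewrite mulr_suml.
  rewrite exchange_big (bigD1 (Ordinal kn)) //= [X in _ + X]big1 => [|j ne].
    under eq_bigr do rewrite mulrAC.
    rewrite -mulr_suml sum_gridJ ?dM // eqxx addr0 nmM nm_nat.
    by [].
  under eq_bigr do rewrite mulrAC.
  rewrite -mulr_suml sum_gridJ ?dM //; case: eqP => [e|_]; last by rewrite mul0r.
  by move: ne; rewrite -val_eqE /= (d_inj j k) ?eqxx //; rewrite inE.
apply: le_trans (nm_sum _ _ _) _; apply: ler_sum => s _.
by rewrite nmM nm_cj nm_gridX mulr1.
Qed.

(** * Paley's inequality by iterated disc automorphisms *)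

Section Paley.
Variables (P : {poly R[i]}) (d : nat -> nat) (lam : R).
Hypothesis d0 : (0 < d 0)%N.
Hypothesis d_lac : forall k, (2 * d k < d k.+1)%N.
Let c k : R[i] := lam%:C * P`_(d k).

(* The conjugate of [psi k] is [\sum_(j < k) theta_j c_j z^(d_j)] plus negative
   frequencies, with [theta_j] close to 1. One step is, to first order in [v], the
   disc automorphism [z |-> (z + conj v) / (1 + v z)], which is why it preserves the
   unit disc once damped by the factor [1 - 2 |v|^2]. *)
Fixpoint psi (k s : nat) : R[i] :=
  if k is k'.+1 then
    (1 - 2 * nm (c k') ^+ 2)%:C *
      (psi k' s + cj (c k') * cj ((w ^+ s) ^+ d k')
        - c k' * (w ^+ s) ^+ d k' * psi k' s ^+ 2)
  else 0.

(** With [t = nm v ^ 2 <= 1/4], the undamped step has squared modulus at most [1 + 4 t], and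
    [(1 - 2 t)^2 (1 + 4 t) <= 1]. *)
Lemma disc_step (z v : R[i]) : nm z <= 1 -> nm v <= 2^-1 ->
  nm ((1 - 2 * nm v ^+ 2)%:C * (z + cj v - v * z ^+ 2)) <= 1.
Proof.
move=> z1 v1; have z0 := nm_ge0 z; have v0 := nm_ge0 v.
have B : nm (z + cj v - v * z ^+ 2) ^+ 2 <= 1 + 4 * nm v ^+ 2.
  have r : complex.Re (v * z) <= nm v * nm z by rewrite -nmM Re_le_nm.
  have q : nm (cj v - v * z ^+ 2) <= 2 * nm v.
    apply: le_trans (nmD _ _) _; rewrite nmN nm_cj nmM nmX.
    have : nm z ^+ 2 <= 1 by rewrite expr_le1.
    nra.
  (* The cross term carries the factor [1 - nm z ^ 2]; as [Re (v z) <= 1/2], the first two terms add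
     up to at most 1. *)
  have e : nm (z + cj v - v * z ^+ 2) ^+ 2 = nm z ^+ 2 +
      2 * (1 - nm z ^+ 2) * complex.Re (v * z) + nm (cj v - v * z ^+ 2) ^+ 2.
    rewrite !sqr_nm; case: z {z1 z0 r q} => a b; case: v {v1 v0} => e f /=; ring.
  have q2 : nm (cj v - v * z ^+ 2) ^+ 2 <= (2 * nm v) ^+ 2.
    by rewrite lerXn2r ?nnegrE ?nm_ge0 // mulr_ge0.
  have z2 : 0 <= 1 - nm z ^+ 2 by rewrite subr_ge0 expr_le1.
  rewrite e.
  have : complex.Re (v * z) <= 2^-1 by nra.
  nra.
rewrite nmM nmR ger0_norm; last by nra.
set y := nm (_ - _) in B *.
have y0 : 0 <= y := nm_ge0 _.
set t := nm v ^+ 2 in B *.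
have t0 : 0 <= t by rewrite sqr_ge0.
have t1 : t <= 4^-1 by rewrite /t; nra.
have a0 : 0 <= 1 - 2 * t by lra.
rewrite -(@expr_le1 _ 2) ?mulr_ge0 // exprMn.
apply: (@le_trans _ _ ((1 - 2 * t) ^+ 2 * (1 + 4 * t))).
  by rewrite ler_wpM2l // sqr_ge0.
have -> : (1 - 2 * t) ^+ 2 * (1 + 4 * t) = 1 - t ^+ 2 * (12 - 16 * t) by ring.
rewrite lerBlDr lerDl mulr_ge0 ?sqr_ge0 //; lra.
Qed.

Lemma psi_le1 k s : (forall j, (j < k)%N -> nm (c j) <= 2^-1) -> nm (psi k s) <= 1.
Proof.
elim: k => [|k IH] ck /=; first by rewrite nm0.
have cz : nm (c k * (w ^+ s) ^+ d k) = nm (c k) by rewrite nmM nm_gridX mulr1.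
rewrite -cz -cjM; apply: disc_step; last by rewrite cz ck.
by apply: IH => j jk; rewrite ck // ltnW.
Qed.

(** The last exponent used by [psi k], or 0 before the first; no frequency of [psi k] lies below
    [- D k]. *)
Let D k := if k is k'.+1 then d k' else 0%N.

Lemma D_lt k : (2 * D k < d k)%N. Proof. by case: k => [|k] //=; rewrite muln0. Qed.

(** Multiplication by [z ^ D k] clears the negative frequencies. As [2 * D k < d k], the quadratic
    correction has positive frequencies only, and the size bound serves to keep them below [M]. *)
Lemma psi_poly k : exists Q : {poly R[i]}, (size Q <= psi_size d k)%N /\
  forall s, psi k s = Q.[w ^+ s] * cj ((w ^+ s) ^+ D k).
Proof.
elim: k => [|k [Q [sQ IH]]] /=.
  by exists 0; rewrite size_poly0; split=> // s; rewrite horner0 mul0r.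
have Dd := D_lt k.
exists ((1 - 2 * nm (c k) ^+ 2)%:C *: (Q * 'X^(d k - D k) + (cj (c k))%:P
          - c k *: (Q ^+ 2 * 'X^(2 * (d k - D k))))); split.
  move: (psi_size d k) sQ => m sQ.
  apply: leq_trans (size_scale_leq _ _) _.
  have s1 : (size (Q * 'X^(d k - D k))%R <= m + d k)%N.
    apply: leq_trans (size_polyMleq _ _) _; rewrite size_polyXn addnS /=.
    by rewrite leq_add // leq_subr.
  have s2 : (size (Q ^+ 2 * 'X^(2 * (d k - D k)))%R <= 2 * m + 2 * d k)%N.
    apply: leq_trans (size_polyMleq _ _) _; rewrite size_polyXn addnS /=.
    apply: leq_add; last by rewrite leq_mul2l leq_subr.
    apply: leq_trans (size_polyMleq _ _) _; apply: leq_trans (leq_pred _) _.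
    by rewrite mul2n -addnn leq_add.
  apply: leq_trans (size_polyD _ _) _; rewrite geq_max size_polyN.
  apply/andP; split; last first.
    by apply: leq_trans (size_scale_leq _ _) _; apply: leq_trans s2 _; lia.
  apply: leq_trans (size_polyD _ _) _; rewrite geq_max; apply/andP; split.
    by apply: leq_trans s1 _; lia.
  by apply: leq_trans (size_polyC_leq1 _) _; lia.
move=> s; rewrite IH hornerZ !hornerD hornerN hornerZ !hornerM !hornerXn hornerC -expr2.
rewrite -[RHS]mulrA; congr (_ * _).
set z := w ^+ s.
have zD : z ^+ d k = z ^+ (d k - D k) * z ^+ D k by rewrite -exprD subnK //; lia.
have z1 n : z ^+ n * cj (z ^+ n) = 1 := gridXJ s n.
rewrite !mulrDl !mulNr; congr (_ + _ - _).
  rewrite zD cjM -!mulrA; congr (_ * _).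
  by rewrite mulrA z1 mul1r.
rewrite -[c k * _ * _ in RHS]mulrA -!mulrA; congr (_ * _).
congr (_ * _); move: (z1 (d k - D k)%N) (z1 (D k)).
rewrite [(2 * _)%N]mulnC [z ^+ (_ * 2)]exprM zD cjM.
move: (Q.[z]) (z ^+ (d k - D k)) (z ^+ D k) => q x y; set x' := cj x; set y' := cj y.
move=> ex ey.
have -> : x * y * (q * y') ^+ 2 = (y * y') * (x * (q ^+ 2 * y')) by ring.
have -> : q * (q * (x ^+ 2 * (x' * y'))) = (x * x') * (x * (q ^+ 2 * y')) by ring.
by rewrite ex ey.
Qed.

(** The mean of [P * psi k] divided by [lam]: the quadratic corrections have mean zero against [P],
    so only the damping and the conjugate characters remain. *)
Fixpoint psi_pairing k : R := if k is k'.+1 then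
  (1 - 2 * nm (c k') ^+ 2) * (psi_pairing k' + nm P`_(d k') ^+ 2) else 0.

Lemma sum_psi k : (size P + psi_size d k <= M)%N ->
  \sum_(s < M) P.[w ^+ s] * psi k s = (M%:R * lam * psi_pairing k)%:C.
Proof.
elim: k => [|k IH] /= PM.
  by rewrite big1 ?mulr0 // => s _; rewrite mulr0.
under eq_bigr do rewrite mulrCA [P.[_] * _]mulrBr [P.[_] * (_ + _)]mulrDr.
move: PM; set x := psi_size d k => PM.
have PM' : (size P + x <= M)%N by apply: leq_trans PM; rewrite leq_add2l; lia.
rewrite -mulr_sumr sumrB big_split /= (IH PM').
have -> : \sum_(s < M) P.[w ^+ s] * (cj (c k) * cj ((w ^+ s) ^+ d k))
    = (M%:R * lam * nm P`_(d k) ^+ 2)%:C.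
  under eq_bigr do rewrite mulrCA.
  rewrite -mulr_sumr mean_coef; [|by apply: leq_trans PM; exact: leq_addr|lia].
  have ck : cj (c k) = lam%:C * cj (P`_(d k)) by rewrite /c cjM cjR.
  rewrite ck.
  have -> : (M%:R * lam * nm P`_(d k) ^+ 2)%:C = M%:R * lam%:C * (P`_(d k) * cj (P`_(d k))).
    by rewrite mul_cj !rmorphM /= rmorph_nat.
  by ring.
have -> : \sum_(s < M) P.[w ^+ s] * (c k * (w ^+ s) ^+ d k * psi k s ^+ 2) = 0.
  have [Q [sQ eQ]] := psi_poly k; have Dd := D_lt k; rewrite -/x in sQ.
  have -> : \sum_(s < M) P.[w ^+ s] * (c k * (w ^+ s) ^+ d k * psi k s ^+ 2)
     = \sum_(s < M) (w ^+ s) ^+ (d k - 2 * D k) * (c k *: (P * Q ^+ 2)).[w ^+ s].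
    apply: eq_bigr => s _; rewrite eQ hornerZ hornerM horner_exp.
    have -> : (w ^+ s) ^+ d k = (w ^+ s) ^+ (d k - 2 * D k) * ((w ^+ s) ^+ D k) ^+ 2.
      by rewrite -[(_ ^+ D k) ^+ 2]exprM -exprD; congr (_ ^+ _); lia.
    have e := gridXJ s (D k).
    set z := w ^+ s in e *; set y := z ^+ D k in e *; set v := z ^+ (_ - _).
    have -> : P.[z] * (c k * (v * y ^+ 2) * (Q.[z] * cj y) ^+ 2)
       = (y * cj y) ^+ 2 * (v * (c k * (P.[z] * Q.[z] ^+ 2))) by ring.
    by rewrite e expr1n mul1r.
  apply: mean_shift; first by lia.
  apply: leq_trans PM.
  have t2 : (size (c k *: (P * Q ^+ 2)) <= size P + 2 * x)%N.
    apply: leq_trans (size_scale_leq _ _) _; apply: leq_trans (size_polyMleq _ _) _.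
    apply: leq_trans (leq_pred _) _; rewrite leq_add2l.
    apply: leq_trans (size_polyMleq _ _) _; apply: leq_trans (leq_pred _) _.
    by rewrite mul2n -addnn leq_add.
  by apply: leq_trans (leq_add t2 (leqnn _)) _; rewrite -addnA leq_add2l; lia.
by rewrite subr0 -rmorphD -rmorphM; congr (_%:C); ring.
Qed.

(** As in the Weierstrass product inequality, the damping factors multiply to at least one minus the
    sum of their defects. *)
Lemma psi_pairing_ge k : 2 * (\sum_(j < k) nm (c j) ^+ 2) <= 1 ->
  (1 - 2 * \sum_(j < k) nm (c j) ^+ 2) * (\sum_(j < k) nm P`_(d j) ^+ 2)
    <= psi_pairing k.
Proof.
elim: k => [|k IH] /=; first by rewrite !big_ord0 !mulr0.
rewrite !big_ord_recr /=; set S := \sum_(_ < _) _; set T := \sum_(_ < _) _.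
set t := nm (c k) ^+ 2; set u := nm _ ^+ 2; move=> h.
have t0 : 0 <= t by exact: sqr_ge0.
have u0 : 0 <= u by exact: sqr_ge0.
have S0 : 0 <= S by apply: sumr_ge0 => i _; exact: sqr_ge0.
have T0 : 0 <= T by apply: sumr_ge0 => i _; exact: sqr_ge0.
have {}IH : (1 - 2 * S) * T <= psi_pairing k by apply: IH; rewrite -/S; lra.
apply: (@le_trans _ _ ((1 - 2 * t) * ((1 - 2 * S) * T + u))); last first.
  by rewrite ler_wpM2l ?lerD2r //; lra.
have tS : 0 <= t * S by exact: mulr_ge0.
have := mulr_ge0 tS T0; have := mulr_ge0 S0 u0; have := mulr_ge0 t0 u0; have := mulr_ge0 t0 T0.
nra.
Qed.

End Paley.

(** Duality: [P] is paired with [psi n], which is bounded by 1. *)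
Lemma paley (P : {poly R[i]}) (d : nat -> nat) n :
  (0 < d 0)%N -> (forall k, (2 * d k < d k.+1)%N) ->
  (size P + psi_size d n <= M)%N ->
  M%:R * l2 n (fun k => nm P`_(d k)) <= 4 * \sum_(s < M) nm P.[w ^+ s].
Proof.
move=> d0 dl PM; set S := l2 n _.
have S0 : 0 <= S := l2_ge0 _ _.
have sum0 : 0 <= \sum_(s < M) nm P.[w ^+ s].
  by apply: sumr_ge0 => s _; exact: nm_ge0.
case: (ltrP 0 S) => [Sp|Sn]; last first.
  have -> : S = 0 by lra.
  by rewrite mulr0 mulr_ge0.
(* The squared moduli of the scaled coefficients then add up to 1/4: each modulus stays within 1/2,
   the damping loses at most a factor 2, and the pairing is at least [M * S / 4]. *)
pose lam := (2 * S)^-1.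
have lam0 : 0 <= lam by rewrite invr_ge0 mulr_ge0.
have nc k : nm (lam%:C * P`_(d k)) = lam * nm P`_(d k) by rewrite nmM nmR ger0_norm.
have lS : lam * S = 2^-1 by rewrite /lam invfM mulfVK ?gt_eqF.
have sc : \sum_(j < n) nm (lam%:C * P`_(d j)) ^+ 2 = 4^-1.
  under eq_bigr do rewrite nc exprMn.
  rewrite -mulr_sumr -(sqr_l2 n (fun j => nm P`_(d j))) -/S -exprMn lS; lra.
have := @psi_pairing_ge P d lam n.
rewrite sc -(sqr_l2 n (fun j => nm P`_(d j))) -/S => /(_ ltac:(lra)) pg.
have := sum_psi lam d0 dl PM => /(congr1 (@nm R)); rewrite nmR ger0_norm; last first.
  rewrite !mulr_ge0 ?ler0n //; apply: le_trans pg; rewrite mulr_ge0 ?sqr_ge0 //; lra.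
move=> e.
have : M%:R * lam * psi_pairing P d lam n <= \sum_(s < M) nm P.[w ^+ s].
  rewrite -e; apply: le_trans (nm_sum _ _ _) _; apply: ler_sum => s _.
  rewrite nmM -[leRHS]mulr1 ler_wpM2l ?nm_ge0 //; apply: psi_le1 => j jn.
  rewrite nc -lS ler_wpM2l //; exact: (@l2_ge_term _ n (fun k => nm P`_(d k))).
have : M%:R * lam * ((1 - 2 * 4^-1) * S ^+ 2) <= M%:R * lam * psi_pairing P d lam n.
  by rewrite ler_wpM2l // mulr_ge0 ?ler0n.
have -> : M%:R * lam * ((1 - 2 * 4^-1) * S ^+ 2) = M%:R * S / 4.
  have -> : M%:R * lam * ((1 - 2 * 4^-1) * S ^+ 2)
     = (lam * S) * (M%:R * S) * (1 - 2 * 4^-1) by ring.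
  rewrite lS; lra.
lra.
Qed.

End Grid.

(** * A slowly varying kernel *)

Section Kernel.
Variables (R : rcfType) (M : nat) (w : R[i]).
Hypothesis M_gt0 : (0 < M)%N.
Hypothesis w_prim : M.-primitive_root w.
Hypothesis chord_ge : forall r, (r <= M)%N ->
  (minn r (M - r))%:R / M%:R <= nm (w ^+ r - 1).

Let MR : 0 < M%:R :> R. Proof. by rewrite ltr0n. Qed.

Definition chord (u y : nat) : R := nm (w ^+ u - w ^+ y).

Lemma chord_ge0 u y : 0 <= chord u y. Proof. exact: nm_ge0. Qed.

Lemma chord_sym u y : chord u y = chord y u. Proof. exact: nmB. Qed.

Lemma chord_tri u y x : chord u x <= chord u y + chord y x.
Proof.
by rewrite /chord -[w ^+ u - w ^+ x](subrKA (w ^+ y)); exact: nmD.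
Qed.

(** A kernel of Poisson type at scale [1 / N], divided by [M] so that plain sums over the grid are
    means. Its quadratic decay is summable, yet slow enough for [ker_slow]. *)
Definition ker (N u y : nat) : R := N%:R / M%:R / (1 + (N%:R * chord u y) ^+ 2).

Lemma ker_den N u y : 0 < 1 + (N%:R * chord u y) ^+ 2.
Proof. by rewrite ltr_wpDr ?sqr_ge0. Qed.

Lemma ker_ge0 N u y : 0 <= ker N u y.
Proof. by rewrite !mulr_ge0 ?invr_ge0 ?ler0n // ltW // ker_den. Qed.

Lemma ker_sym N u y : ker N u y = ker N y u.
Proof. by rewrite /ker chord_sym. Qed.

(** Telescoping: with [t = c * n] a term is at most [1 / ((1 + t) (1 + t + c))], a difference
    quotient of [1 / (1 + t)]. *)
Lemma sum_inv_sqr (c : R) n : 0 < c ->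
  \sum_(u < n) ((1 + c * u.+1%:R) ^+ 2)^-1 <= c^-1 * (1 - (1 + c * n%:R)^-1).
Proof.
move=> c0; elim: n => [|n IH]; first by rewrite big_ord0 mulr0 addr0 invr1 subrr mulr0.
rewrite big_ord_recr /=; apply: le_trans (lerD IH (lexx _)) _.
set t := c * n%:R.
have -> : c * n.+1%:R = t + c by rewrite -natr1 mulrDr mulr1.
have t0 : 0 <= t by rewrite mulr_ge0 ?ler0n ?ltW.
have n1 : 1 + t != 0 by apply: lt0r_neq0; lra.
have n2 : 1 + (t + c) != 0 by apply: lt0r_neq0; lra.
have e : c^-1 * (1 - (1 + (t + c))^-1) - (c^-1 * (1 - (1 + t)^-1)) = ((1 + t) * (1 + (t + c)))^-1.
  by field; rewrite n1 n2 gt_eqF.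
rewrite -lerBrDl e lef_pV2 ?posrE ?exprn_gt0 ?mulr_gt0; [|lra..].
by rewrite expr2 ler_wpM2r; lra.
Qed.

Lemma ker_mass N y : (0 < N)%N -> (N <= M)%N -> (y < M)%N ->
  \sum_(u < M) ker N u y <= 6.
Proof.
move=> N0 NM yM.
have NR : 0 < N%:R :> R by rewrite ltr0n.
pose k z : R := N%:R / M%:R / (1 + (N%:R * nm (z - 1)) ^+ 2).
have -> : \sum_(u < M) ker N u y = \sum_(u < M) k (w ^+ u).
  rewrite -(sum_grid_rot M_gt0 w_prim k (M - y)); apply: eq_bigr => u _.
  rewrite /k /ker /chord; congr (_ / (1 + (_ * _) ^+ 2)).
  have e : w ^+ y * w ^+ (M - y) = 1.
    by rewrite -exprD subnKC ?(prim_expr_order w_prim) // ltnW.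
  by rewrite -[X in _ = nm (_ - X)]e -mulrBl nmM (nm_grid M_gt0 w_prim) mulr1.
pose c : R := N%:R / M%:R.
have c0 : 0 < c by rewrite divr_gt0.
have c1 : c <= 1 by rewrite ler_pdivrMr // mul1r ler_nat.
have sq (x t : R) : 0 <= x -> x <= t -> (1 + t ^+ 2)^-1 <= 2 * ((1 + x) ^+ 2)^-1.
  move=> x0 xt.
  have d1 : 0 < (1 + x) ^+ 2 by rewrite exprn_gt0 // ltr_wpDr.
  have d2 : 0 < 1 + t ^+ 2 by rewrite ltr_wpDr // sqr_ge0.
  rewrite -[leLHS]mul1r ler_pdivrMr // mulrAC ler_pdivlMr // mul1r.
  have : 0 <= (t - x) * (t + x) by rewrite mulr_ge0 //; lra.
  have := sqr_ge0 (1 - x); nra.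
(* Adding the contributions of both arcs avoids the minimum and leaves two sums of the same form. *)
have kb (u : 'I_M) : k (w ^+ u) <= 2 * c * (((1 + c * u%:R) ^+ 2)^-1
    + ((1 + c * (M - u)%:R) ^+ 2)^-1).
  rewrite /k -/c [2 * c]mulrC -[leRHS]mulrA ler_wpM2l ?(ltW c0) // mulrDr.
  have p1 : 0 <= 2 * ((1 + c * u%:R) ^+ 2)^-1 by rewrite mulr_ge0 ?invr_ge0 ?sqr_ge0.
  have p2 : 0 <= 2 * ((1 + c * (M - u)%:R) ^+ 2)^-1 by rewrite mulr_ge0 ?invr_ge0 ?sqr_ge0.
  have lo := chord_ge (ltnW (ltn_ord u)).
  have cN (i : nat) : c * i%:R = N%:R * (i%:R / M%:R) by rewrite /c; ring.
  have le_c (i : nat) : i = minn u (M - u) -> c * i%:R <= N%:R * nm (w ^+ u - 1).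
    by move=> ->; rewrite cN ler_wpM2l // ltW.
  case: (leqP u (M - u)) => h.
    apply: le_trans (sq (c * u%:R) _ _ _) _; last by rewrite lerDl.
      by rewrite mulr_ge0 ?ler0n ?ltW.
    by apply: le_c; lia.
  apply: le_trans (sq (c * (M - u)%:R) _ _ _) _; last by rewrite lerDr.
    by rewrite mulr_ge0 ?ler0n ?ltW.
  by apply: le_c; lia.
apply: le_trans (ler_sum _ (fun u _ => kb u)) _.
rewrite -mulr_sumr big_split /=.
have -> : \sum_(u < M) ((1 + c * (M - u)%:R) ^+ 2)^-1
    = \sum_(u < M) ((1 + c * u.+1%:R) ^+ 2)^-1 :> R.
  rewrite (reindex_inj rev_ord_inj); apply: eq_bigr => u _ /=.
  by rewrite subKn.
have sb n : \sum_(u < n) ((1 + c * u.+1%:R) ^+ 2)^-1 <= c^-1.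
  apply: le_trans (sum_inv_sqr n c0) _.
  rewrite -[leRHS]mulr1 ler_wpM2l ?invr_ge0 ?(ltW c0) // lerBlDr lerDl invr_ge0.
  by rewrite addr_ge0 // mulr_ge0 ?ler0n ?(ltW c0).
have sb' n : \sum_(u < n) ((1 + c * u%:R) ^+ 2)^-1 <= 1 + c^-1.
  case: n => [|n]; first by rewrite big_ord0 addr_ge0 // invr_ge0 ltW.
  by rewrite big_ord_recl /= mulr0 addr0 expr1n invr1 lerD2l sb.
apply: (@le_trans _ _ (2 * c * ((1 + c^-1) + c^-1))).
  by apply: ler_wpM2l; [rewrite mulr_ge0 ?(ltW c0)|apply: lerD; [exact: sb'|exact: sb]].
have -> : 2 * c * (1 + c^-1 + c^-1) = 2 * c + 4 * (c * c^-1) by ring.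
rewrite mulfV ?gt_eqF //; lra.
Qed.

(** Peetre's inequality: [p <= q + r] gives [1 + p^2 <= 2 (1 + q^2) (1 + r^2)]. *)
Lemma ker_slow N u y x :
  ker N y x <= 2 * (1 + (N%:R * chord u y) ^+ 2) * ker N u x.
Proof.
rewrite /ker mulrCA ler_wpM2l ?divr_ge0 ?ler0n //.
rewrite -[leLHS]mul1r ler_pdivrMr ?ker_den // mulrAC ler_pdivlMr ?ker_den // mul1r.
have t : N%:R * chord u x <= N%:R * chord u y + N%:R * chord y x.
  by rewrite -mulrDr ler_wpM2l ?ler0n ?chord_tri.
have p0 : 0 <= N%:R * chord u x by rewrite mulr_ge0 ?ler0n ?chord_ge0.
move: t p0; set p := _ * chord u x; set q := _ * chord u y; set r := _ * chord y x.
move=> t p0.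
have : p ^+ 2 <= (q + r) ^+ 2 by rewrite lerXn2r ?nnegrE // (le_trans p0).
have := sqr_ge0 (q - r); have := sqr_ge0 (q * r); have := sqr_ge0 q; nra.
Qed.

(** At distance [t >= 1 / N] both kernels are in their tails, of order [1 / (M N t^2)] and
    [1 / (M N' t^2)]. *)
Lemma ker_coarse N N' u y : (0 < N)%N -> (N <= N')%N -> 1 <= N%:R * chord u y ->
  ker N' u y <= 2 * (N%:R / N'%:R) * ker N u y.
Proof.
move=> N0 NN' h; have N0' : (0 < N')%N by apply: leq_trans NN'.
have NR : 0 < N%:R :> R by rewrite ltr0n.
have NR' : 0 < N'%:R :> R by rewrite ltr0n.
rewrite /ker; set t := chord u y in h *.
have t0 : 0 <= t := chord_ge0 _ _.
have -> : 2 * (N%:R / N'%:R) * (N%:R / M%:R / (1 + (N%:R * t) ^+ 2))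
   = M%:R^-1 * (2 * N%:R ^+ 2 / (N'%:R * (1 + (N%:R * t) ^+ 2))).
  by field; rewrite !gt_eqF // ltr_wpDr ?sqr_ge0.
rewrite [N'%:R / M%:R]mulrC -[leLHS]mulrA ler_wpM2l ?invr_ge0 ?(ltW MR) //.
have d1 : 0 < 1 + (N'%:R * t) ^+ 2 by rewrite ltr_wpDr ?sqr_ge0.
have d2 : 0 < 1 + (N%:R * t) ^+ 2 by rewrite ltr_wpDr ?sqr_ge0.
rewrite ler_pdivrMr // mulrAC ler_pdivlMr ?mulr_gt0 //.
have h2 : 1 <= (N%:R * t) ^+ 2 by rewrite exprn_ege1.
have -> : N'%:R * (N'%:R * (1 + (N%:R * t) ^+ 2)) = N'%:R ^+ 2 * (1 + (N%:R * t) ^+ 2) by ring.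
apply: (@le_trans _ _ (N'%:R ^+ 2 * (2 * (N%:R * t) ^+ 2))).
  by rewrite ler_wpM2l ?sqr_ge0 //; lra.
have -> : N'%:R ^+ 2 * (2 * (N%:R * t) ^+ 2) = 2 * N%:R ^+ 2 * (N'%:R * t) ^+ 2 by ring.
by rewrite ler_wpM2l ?mulr_ge0 ?sqr_ge0 // lerDr.
Qed.

(** One of the two legs is at least half of the distance from [u] to [x], and the kernel on that leg
    is at most a constant times [ker N u x]. *)
Lemma ker_mul N u y x :
  ker N u y * ker N y x <= 2 * ker N u x * (ker N u y + ker N y x).
Proof.
have t : N%:R * chord u x <= N%:R * chord u y + N%:R * chord y x.
  by rewrite -mulrDr ler_wpM2l ?ler0n ?chord_tri.
have p0 : 0 <= N%:R * chord u x by rewrite mulr_ge0 ?ler0n ?chord_ge0.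
rewrite /ker; set c := N%:R / M%:R; have c0 : 0 <= c by rewrite divr_ge0 ?ler0n.
move: t p0; set p := _ * chord u x; set q := _ * chord u y; set r := _ * chord y x.
move=> t p0.
have h : p ^+ 2 <= (q + r) ^+ 2 by rewrite lerXn2r ?nnegrE // (le_trans p0).
have X0 := sqr_ge0 q; have Y0 := sqr_ge0 r.
have S : 1 + p ^+ 2 <= 2 * (2 + q ^+ 2 + r ^+ 2) by have := sqr_ge0 (q - r); nra.
have P0 := sqr_ge0 p.
move: (p ^+ 2) (q ^+ 2) (r ^+ 2) X0 Y0 S P0 => P X Y X0 Y0 S P0.
have dX : 0 < 1 + X by lra.
have dY : 0 < 1 + Y by lra.
have dP : 0 < 1 + P by lra.
have -> : c / (1 + X) * (c / (1 + Y)) = c ^+ 2 * ((1 + X) * (1 + Y))^-1.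
  by field; rewrite !gt_eqF.
have -> : 2 * (c / (1 + P)) * (c / (1 + X) + c / (1 + Y))
   = c ^+ 2 * (2 * (2 + X + Y) / (1 + P) / ((1 + X) * (1 + Y))).
  by field; rewrite !gt_eqF.
rewrite ler_wpM2l ?sqr_ge0 // ler_peMl ?invr_ge0 ?mulr_ge0 ?(ltW dX) ?(ltW dY) //.
by rewrite ler_pdivlMr // mul1r.
Qed.

Lemma ker_conv N u x : (0 < N)%N -> (N <= M)%N -> (u < M)%N -> (x < M)%N ->
  \sum_(y < M) ker N u y * ker N y x <= 24 * ker N u x.
Proof.
move=> N0 NM uM xM.
apply: (@le_trans _ _ (\sum_(y < M) 2 * ker N u x * (ker N u y + ker N y x))).
  by apply: ler_sum => y _; exact: ker_mul.
rewrite -mulr_sumr big_split /=.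
have m1 := ker_mass N0 NM xM; have := ker_mass N0 NM uM.
under eq_bigr do rewrite ker_sym.
move=> m2; have k0 := ker_ge0 N u x.
have -> : 24 * ker N u x = 2 * ker N u x * (6 + 6) by ring.
by apply: ler_wpM2l; [rewrite mulr_ge0|lra].
Qed.

(** A kernel of de la Vallee Poussin type, [Dir (2 * N)] times the conjugate of [Dir N] divided by
    [M * N], reproduces the monomials up to degree [N]. *)
Lemma reproducing (P : {poly R[i]}) N (u : nat) : (0 < N)%N -> (2 * N <= M)%N ->
  (size P <= N.+1)%N ->
  nm P.[w ^+ u] <= 6 * \sum_(y < M) ker N u y * nm P.[w ^+ y].
Proof.
move=> N0 NM sP.
have NR : 0 < N%:R :> R by rewrite ltr0n.
pose zeta (y : nat) : R[i] := w ^+ u * cj (w ^+ y).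
pose Dir n (z : R[i]) : R[i] := \sum_(i < n) z ^+ i.
have DirM n z : (z - 1) * Dir n z = z ^+ n - 1 by rewrite subrX1.
have nz y : nm (zeta y) = 1 by rewrite nmM nm_cj !(nm_grid M_gt0 w_prim) mulr1.
have Dir1 n y : nm (Dir n (zeta y)) <= n%:R.
  apply: le_trans (nm_sum _ _ _) _.
  by under eq_bigr do rewrite nmX nz expr1n; rewrite sumr_const card_ord.
have ch y : chord u y = nm (zeta y - 1).
  rewrite /chord /zeta -(gridJ M_gt0 w_prim y) -mulrBl nmM nm_cj (nm_grid M_gt0 w_prim) mulr1.
  by [].
have Dir2 n y : chord u y * nm (Dir n (zeta y)) <= 2.
  rewrite ch -nmM DirM; apply: le_trans (nmD _ _) _.
  by rewrite nmN nm1 nmX nz expr1n.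
(* For [n <= N] and [i < N] exactly one [j < 2 * N] equals [n + i], so every [i] contributes the
   same. *)
have mono n : (n <= N)%N -> \sum_(y < M) (w ^+ y) ^+ n *
    (Dir (2 * N)%N (zeta y) * cj (Dir N (zeta y))) = M%:R * N%:R * (w ^+ u) ^+ n.
  move=> nN.
  have E (y : 'I_M) : (w ^+ y) ^+ n * (Dir (2 * N)%N (zeta y) * cj (Dir N (zeta y)))
    = \sum_(i < N) \sum_(j < 2 * N) (w ^+ u) ^+ j * cj ((w ^+ u) ^+ i) *
        ((w ^+ y) ^+ (n + i) * cj ((w ^+ y) ^+ j)).
    rewrite /Dir cj_sum mulr_suml mulr_sumr [RHS]exchange_big /=.
    apply: eq_bigr => j _; rewrite !mulr_sumr; apply: eq_bigr => i _.
    rewrite /zeta !exprMn !cjM !cjX cjK exprD.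
    by ring.
  under eq_bigr do rewrite E.
  rewrite exchange_big /=.
  have I (i : 'I_N) : \sum_(y < M) \sum_(j < 2 * N) (w ^+ u) ^+ j * cj ((w ^+ u) ^+ i) *
        ((w ^+ y) ^+ (n + i) * cj ((w ^+ y) ^+ j)) = M%:R * (w ^+ u) ^+ n.
    have niN : (n + i < 2 * N)%N by have := ltn_ord i; lia.
    rewrite exchange_big (bigD1 (Ordinal niN)) //= [X in _ + X]big1 => [|j ne].
      rewrite -mulr_sumr (sum_gridJ M_gt0 w_prim) ?eqxx; [|lia..].
      by rewrite addr0 exprD -[_ * _ * cj _]mulrA (gridXJ M_gt0 w_prim) mulr1 mulrC.
    rewrite -mulr_sumr (sum_gridJ M_gt0 w_prim); [|by have := ltn_ord j; lia..].
    case: eqP => [e|_]; last by rewrite mulr0.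
    by move: ne; rewrite -val_eqE /= e eqxx.
  under eq_bigr do rewrite I.
  by rewrite sumr_const card_ord -mulr_natr; ring.
have rep : M%:R * N%:R * P.[w ^+ u] = \sum_(y < M) P.[w ^+ y] *
    (Dir (2 * N)%N (zeta y) * cj (Dir N (zeta y))).
  under eq_bigr do rewrite (horner_coef_wide _ sP) mulr_suml.
  rewrite (horner_coef_wide _ sP) mulr_sumr exchange_big /=.
  apply: eq_bigr => n _; under eq_bigr do rewrite -mulrA.
  by rewrite -mulr_sumr (mono n (ltn_ord n)) mulrCA.
have MN0 : 0 < M%:R * N%:R :> R by rewrite mulr_gt0.
rewrite -(ler_pM2l MN0).
have -> : M%:R * N%:R * nm P.[w ^+ u] = nm (M%:R * N%:R * P.[w ^+ u]).
  by rewrite !nmM !nm_nat.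
rewrite rep; apply: le_trans (nm_sum _ _ _) _.
rewrite mulrA mulr_sumr; apply: ler_sum => y _.
rewrite nmM [leRHS]mulrA [leLHS]mulrC; apply: ler_wpM2r; first exact: nm_ge0.
rewrite nmM nm_cj.
have := Dir1 (2 * N)%N y; have := Dir1 N y; have := Dir2 (2 * N)%N y; have := Dir2 N y.
have := nm_ge0 (Dir (2 * N)%N (zeta y)); have := nm_ge0 (Dir N (zeta y)).
have t0 := chord_ge0 u y.
rewrite /ker; set a := nm (Dir (2 * N)%N _); set b := nm (Dir N _).
move: t0; set t := chord u y => t0 b0 a0 tb ta bN aN.
have -> : M%:R * N%:R * 6 * (N%:R / M%:R / (1 + (N%:R * t) ^+ 2))
   = 6 * N%:R ^+ 2 / (1 + (N%:R * t) ^+ 2).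
  by field; rewrite !gt_eqF // ltr_wpDr ?sqr_ge0.
rewrite ler_pdivlMr ?ltr_wpDr ?sqr_ge0 //.
(* Size gives the bound [2 N^2] and decay gives [4 / t^2]; together they give
   [6 N^2 / (1 + (N t)^2)]. *)
have e1 : a * b <= 2 * N%:R ^+ 2.
  by rewrite expr2 mulrA; apply: ler_pM => //; rewrite natrM in aN.
have e2 : (t * a) * (t * b) <= 2 * 2 by apply: ler_pM => //; exact: mulr_ge0.
have := sqr_ge0 (N%:R : R).
have -> : a * b * (1 + (N%:R * t) ^+ 2) = a * b + N%:R ^+ 2 * ((t * a) * (t * b)) by ring.
nra.
Qed.

End Kernel.

(** * Decoupling *)

Section Blocks.
Variables (M L : nat).
Hypothesis L_gt0 : (0 < L)%N.
Hypothesis L_dvd : (L %| M)%N.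

(* The point of the block of [u] congruent to [v] modulo the block length. *)
Definition blk (u v : nat) := (u %/ L * L + v %% L)%N.

Lemma blk_lt u v : (u < M)%N -> (blk u v < M)%N.
Proof.
move=> uM; have lt := ltn_pmod v L_gt0.
have : (u %/ L < M %/ L)%N by rewrite ltn_divLR // divnK.
have := divnK L_dvd; rewrite /blk; nia.
Qed.

Lemma blk_div u v : (blk u v %/ L = u %/ L)%N.
Proof. by rewrite /blk divnMDl // (divn_small (ltn_pmod _ L_gt0)) addn0. Qed.

Lemma blk_mod u v : (blk u v %% L = v %% L)%N.
Proof. by rewrite /blk modnMDl modn_mod. Qed.

Lemma blkK u v : blk (blk u v) (blk v u) = u.
Proof. by rewrite {1}/blk blk_div blk_mod -divn_eq. Qed.

(** The map [(u, v) |-> (blk u v, blk v u)] is an involution of the pairs, so for independent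
    uniform [u] and [v] the point [blk u v] is again uniform. *)
Lemma sum_blk (T : nmodType) (f : nat -> T) :
  \sum_(u < M) \sum_(v < M) f (blk u v) = \sum_(u < M) f u *+ M.
Proof.
pose sw (p : 'I_M * 'I_M) := (Ordinal (blk_lt p.2 (ltn_ord p.1)),
                              Ordinal (blk_lt p.1 (ltn_ord p.2))).
have swK : involutive sw.
  by move=> [u v]; congr (_, _); apply: val_inj; exact: blkK.
rewrite pair_bigA /= (reindex_inj (inv_inj swK)) /=.
under eq_bigr do rewrite blkK.
rewrite -(pair_bigA _ (fun (u v : 'I_M) => f u)) /=.
by apply: eq_bigr => u _; rewrite sumr_const card_ord.
Qed.

Lemma sum_div (T : nmodType) (f : nat -> T) N :
  \sum_(u < N * L) f (u %/ L)%N = \sum_(i < N) f i *+ L.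
Proof.
elim: N => [|N IH]; first by rewrite mul0n !big_ord0.
rewrite mulSnr big_split_ord /= IH big_ord_recr /=; congr (_ + _).
rewrite (eq_bigr (fun=> f N)) ?sumr_const ?card_ord // => r _ /=.
by rewrite divnMDl // divn_small ?addn0 // ltn_ord.
Qed.

End Blocks.

(** * The decoupling inequality *)

Section Decoupling.
Variables (R : rcfType) (M : nat) (w : R[i]).
Hypothesis M_gt0 : (0 < M)%N.
Hypothesis w_prim : M.-primitive_root w.
Hypothesis chord_le : forall r, (r <= M)%N -> nm (w ^+ r - 1) <= 7 * r%:R / M%:R.
Hypothesis chord_ge : forall r, (r <= M)%N ->
  (minn r (M - r))%:R / M%:R <= nm (w ^+ r - 1).

Let MR : 0 < M%:R :> R. Proof. by rewrite ltr0n. Qed.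

Variables (n : nat) (N : nat -> nat) (g : nat -> nat -> R).
Hypothesis g_ge0 : forall k u, 0 <= g k u.
Hypothesis N_gt0 : forall k, (0 < N k)%N.
Hypothesis N_double : forall k, (2 * N k <= N k.+1)%N.
Hypothesis N_dvdM : forall k, (k <= n)%N -> (N k %| M)%N.

Lemma N_le j k : (j <= k)%N -> (N j <= N k)%N.
Proof.
move/subnKC <-; elim: (k - j)%N => [|i IH]; rewrite ?addn0 // addnS.
by apply: leq_trans IH _; apply: leq_trans (N_double _); rewrite leq_pmull.
Qed.

Lemma N_leM k : (k <= n)%N -> (N k <= M)%N.
Proof. by move=> kn; rewrite dvdn_leq ?N_dvdM. Qed.

Lemma N_geom k : (\sum_(j < k) N j.+1 <= N k.+1)%N.
Proof.
elim: k => [|k IH]; first by rewrite big_ord0.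
rewrite big_ord_recr /=; apply: leq_trans (leq_add IH (leqnn _)) _.
by have := N_double k.+1; lia.
Qed.

(** The smoothing of [g k] at scale [1 / N k.+1]. Built from the indices below [k], [amp k] varies
    at scale [1 / N k] and serves as the past [a_k]. *)
Definition envelope k u := \sum_(y < M) ker M w (N k.+1) u y * g k y.
Definition amp k u := l2 k (fun j => envelope j u).

Lemma envelope_ge0 k u : 0 <= envelope k u.
Proof. by apply: sumr_ge0 => y _; rewrite mulr_ge0 ?ker_ge0. Qed.

Lemma amp_ge0 k u : 0 <= amp k u. Proof. exact: l2_ge0. Qed.

Lemma envelope_slow k u y :
  envelope k y <= 2 * (1 + ((N k.+1)%:R * chord w u y) ^+ 2) * envelope k u.
Proof.
rewrite /envelope mulr_sumr; apply: ler_sum => x _; rewrite mulrA.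
by rewrite ler_wpM2r // ker_slow.
Qed.

Lemma ker_envelope k u : (k < n)%N -> (u < M)%N ->
  \sum_(y < M) ker M w (N k.+1) u y * envelope k y <= 24 * envelope k u.
Proof.
move=> kn uM; rewrite /envelope mulr_sumr.
under eq_bigr do rewrite mulr_sumr.
rewrite exchange_big /=; apply: ler_sum => x _.
under eq_bigr do rewrite mulrA.
rewrite -mulr_suml mulrA ler_wpM2r //.
by apply: ker_conv => //; exact: N_leM.
Qed.

(* Close to [u] every [envelope j] is comparable to its value at [u]; at distance [t],
   those with [N j.+1 * t > 1] are added up in l1 norm, and the decay of the finer
   kernel makes this sum geometric. *)
Lemma ker_amp_pointwise k u y :
  ker M w (N k.+1) u y * amp k y <= 4 * (ker M w (N k.+1) u y * amp k u)
    + \sum_(j < k) 2 * ((N j.+1)%:R / (N k.+1)%:R) * (ker M w (N j.+1) u y * envelope j y).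
Proof.
set t := chord w u y; have t0 : 0 <= t := chord_ge0 _ _ _.
pose x' j := if (N j.+1)%:R * t <= 1 then 0 else envelope j y.
have x'0 j : 0 <= x' j by rewrite /x'; case: ifP => // _; exact: envelope_ge0.
have k0 : 0 <= ker M w (N k.+1) u y := ker_ge0 _ _ _ _ _.
have a_le : amp k y <= 4 * amp k u + \sum_(j < k) x' j.
  apply: (@le_trans _ _ (l2 k (fun j => 4 * envelope j u + x' j))).
    apply: l2_le => j _; rewrite !ger0_norm ?addr_ge0 ?mulr_ge0 ?envelope_ge0 //.
    rewrite /x'; case: ifP => [h|_]; last by rewrite lerDr mulr_ge0 ?envelope_ge0.
    rewrite addr0; apply: le_trans (envelope_slow j u y) _.
    rewrite ler_wpM2r ?envelope_ge0 // -/t.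
    have : ((N j.+1)%:R * t) ^+ 2 <= 1 by rewrite expr_le1 // mulr_ge0 ?ler0n.
    lra.
  apply: le_trans (l2D _ _ _) _; rewrite l2Z // lerD2l.
  exact: l2_le_l1.
apply: le_trans (ler_wpM2l k0 a_le) _.
rewrite mulrDr [ker _ _ _ _ _ * (4 * _)]mulrCA lerD2l mulr_sumr.
apply: ler_sum => j _; rewrite /x'; case: ifP => [_|/negbT h].
  rewrite mulr0; apply: mulr_ge0; first by rewrite mulr_ge0 ?divr_ge0 ?ler0n.
  by apply: mulr_ge0; [exact: ker_ge0|exact: envelope_ge0].
rewrite [leRHS]mulrA; apply: ler_wpM2r; first exact: envelope_ge0.
apply: ker_coarse => //.
  by apply: N_le; rewrite ltnS ltnW.
by rewrite ltW // ltNge.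
Qed.

(** The near part contributes [4 * 6] by the mass of the kernel, the far part [2 * 24] by its
    convolution bound and the geometric growth of [N]. *)
Lemma ker_amp k u : (k < n)%N -> (u < M)%N ->
  \sum_(y < M) ker M w (N k.+1) u y * amp k y <= 72 * amp k u.
Proof.
move=> kn uM; have NkR : 0 < (N k.+1)%:R :> R by rewrite ltr0n.
apply: (@le_trans _ _ (\sum_(y < M) (4 * (ker M w (N k.+1) u y * amp k u)
    + \sum_(j < k) 2 * ((N j.+1)%:R / (N k.+1)%:R) * (ker M w (N j.+1) u y * envelope j y)))).
  by apply: ler_sum => y _; exact: ker_amp_pointwise.
rewrite big_split /= -mulr_sumr -mulr_suml exchange_big /=.
have m : \sum_(y < M) ker M w (N k.+1) u y <= 6.
  under eq_bigr do rewrite ker_sym.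
  by apply: ker_mass => //; exact: N_leM.
have p1 : (\sum_(y < M) ker M w (N k.+1) u y) * amp k u <= 6 * amp k u.
  by rewrite ler_wpM2r ?amp_ge0.
have p2 : \sum_(j < k) \sum_(y < M)
    2 * ((N j.+1)%:R / (N k.+1)%:R) * (ker M w (N j.+1) u y * envelope j y)
    <= \sum_(j < k) 48 * amp k u / (N k.+1)%:R * (N j.+1)%:R.
  apply: ler_sum => j _; rewrite -mulr_sumr.
  have -> : 48 * amp k u / (N k.+1)%:R * (N j.+1)%:R
     = 2 * ((N j.+1)%:R / (N k.+1)%:R) * (24 * amp k u) by ring.
  rewrite ler_wpM2l ?mulr_ge0 ?invr_ge0 ?ler0n //.
  apply: le_trans (ker_envelope _ uM) _; first by rewrite (ltn_trans _ kn).
  by rewrite ler_wpM2l // (@l2_ge_term _ k (fun j => envelope j u)).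
have p3 : \sum_(j < k) 48 * amp k u / (N k.+1)%:R * (N j.+1)%:R <= 48 * amp k u.
  rewrite -mulr_sumr -natr_sum -mulrA -[leRHS]mulr1.
  rewrite ler_wpM2l ?mulr_ge0 ?amp_ge0 // mulrC ler_pdivrMr // mul1r ler_nat.
  exact: N_geom.
have := amp_ge0 k u; lra.
Qed.

(** By [ker_amp] the past may be replaced by its kernel average at cost 72. Joint convexity of [Phi]
    then takes the averages of past and increment outside together, and the kernel mass 6 gives
    [432 = 72 * 6]. *)
Lemma sum_Phi_envelope k : (k < n)%N ->
  \sum_(u < M) Phi (amp k u) (envelope k u) <= 432 * \sum_(u < M) Phi (amp k u) (g k u).
Proof.
move=> kn.
apply: (@le_trans _ _ (\sum_(u < M) 72 *
    \sum_(y < M) ker M w (N k.+1) u y * Phi (amp k y) (g k y))).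
  apply: ler_sum => u _.
  have s0 : 0 <= \sum_(y < M) ker M w (N k.+1) u y * amp k y.
    by apply: sumr_ge0 => y _; rewrite mulr_ge0 ?ker_ge0 ?amp_ge0.
  apply: le_trans (@Phi_scale _ 72 _ _ _ _ s0 (amp_ge0 k u) (ker_amp kn (ltn_ord u))) _.
    by lra.
  rewrite ler_wpM2l // /envelope.
  apply: (@Phi_convex _ _ _ (fun y : 'I_M => amp k y) (fun y : 'I_M => g k y)) => y.
  exact: ker_ge0.
rewrite -mulr_sumr exchange_big /=.
have -> : 432 = 72 * 6 :> R by ring.
rewrite -mulrA ler_wpM2l // mulr_sumr; apply: ler_sum => y _.
rewrite -mulr_suml ler_wpM2r ?Phi_ge0 ?amp_ge0 //.
by apply: ker_mass => //; exact: N_leM.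
Qed.

(** The distance bound turns the factor of [envelope_slow] into at most [2 (1 + 7^2) = 100]. *)
Lemma amp_block k u y : (k <= n)%N -> chord w u y <= 7 / (N k)%:R ->
  amp k u <= 100 * amp k y.
Proof.
move=> kn h; have NkR : 0 < (N k)%:R :> R by rewrite ltr0n.
rewrite -l2Z //; apply: l2_le => j jk.
rewrite !ger0_norm ?mulr_ge0 ?envelope_ge0 //.
apply: le_trans (envelope_slow j y u) _; rewrite ler_wpM2r ?envelope_ge0 //.
have c0 := chord_ge0 w y u.
have : (N j.+1)%:R * chord w y u <= 7.
  apply: (@le_trans _ _ ((N k)%:R * (7 / (N k)%:R))); last by rewrite mulrCA divff ?mulr1 ?gt_eqF.
  by rewrite chord_sym ler_pM ?ler0n ?chord_ge0 // ler_nat N_le.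
have : 0 <= (N j.+1)%:R * chord w y u by rewrite mulr_ge0 ?ler0n.
nra.
Qed.

(** Both points lie in one block of length [M / N k]. *)
Lemma chord_blk k u v : (k <= n)%N -> (u < M)%N ->
  chord w u (blk (M %/ N k) u v) <= 7 / (N k)%:R.
Proof.
move=> kn uM; set L := (M %/ N k)%N.
have LM : (L * N k = M)%N by rewrite divnK // N_dvdM.
have L0 : (0 < L)%N by have := N_gt0 k; nia.
have NR : 0 < (N k)%:R :> R by rewrite ltr0n.
have ch a b : (a <= b)%N -> chord w a b = nm (w ^+ (b - a) - 1).
  move=> ab; rewrite /chord -[in w ^+ b](subnKC ab) exprD -[X in X - _]mulr1 -mulrBr nmM.
  by rewrite (nm_grid M_gt0 w_prim) mul1r nmB.
have bd r : (r <= L)%N -> nm (w ^+ r - 1) <= 7 / (N k)%:R.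
  move=> rL; apply: le_trans (chord_le _) _; first by have := N_gt0 k; nia.
  rewrite -mulrA ler_wpM2l // ler_pdivrMr // mulrC ler_pdivlMr //.
  by rewrite -natrM ler_nat; nia.
have e1 := divn_eq u L; have := ltn_pmod u L0; have := ltn_pmod v L0.
case: (leqP u (blk L u v)) => h l1 l2.
  by rewrite ch //; apply: bd; rewrite /blk in h *; lia.
by rewrite chord_sym ch ?(ltnW h) //; apply: bd; rewrite /blk in h *; lia.
Qed.

Hypothesis g_le_envelope : forall k u, (k < n)%N -> (u < M)%N -> g k u <= 6 * envelope k u.

(** The true past is at most [6 * amp k], so measuring increments from [amp k] costs a factor 6, and
    the true increments telescope. *)
Lemma sum_Phi_g :
  \sum_(k < n) \sum_(u < M) Phi (amp k u) (g k u)
    <= 6 * \sum_(u < M) l2 n (fun k => g k u).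
Proof.
rewrite exchange_big mulr_sumr; apply: ler_sum => u _.
rewrite l2_telescope mulr_sumr; apply: ler_sum => k _.
apply: Phi_scale; rewrite ?l2_ge0 //; first by lra.
rewrite -l2Z //; apply: l2_le => j jk.
rewrite !ger0_norm ?mulr_ge0 ?envelope_ge0 //.
by apply: g_le_envelope => //; rewrite (ltn_trans jk).
Qed.

Variable h : nat -> nat -> R.
Hypothesis h_ge0 : forall k v, 0 <= h k v.
Hypothesis h_le : forall k v, (k < n)%N -> (v < M)%N ->
  M%:R * h k v <= \sum_(u < M) g k (blk (M %/ N k) u v).

Theorem decoupling :
  \sum_(v < M) l2 n (fun k => h k v) <= 3192 * \sum_(u < M) l2 n (fun k => g k u).
Proof.
rewrite -(ler_pM2l MR) mulr_sumr.
(* The tangent sequence: the value of [g k] in the block of [u] at the relative position of [v]. Its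
   average over [u] bounds [h k v], while the past is taken at [u]. *)
pose W k u v := g k (blk (M %/ N k) u v).
apply: (@le_trans _ _ (\sum_(v < M) \sum_(u < M) \sum_(k < n)
   (Phi (amp k u) (W k u v) + Phi (amp k u) (envelope k u)))).
  apply: ler_sum => v _.
  rewrite -l2Z ?(ltW MR) //.
  apply: (@le_trans _ _ (l2 n (fun k => \sum_(u < M) W k u v))).
    apply: l2_le => k kn; rewrite !ger0_norm ?h_le ?mulr_ge0 ?ler0n //.
    by apply: sumr_ge0 => u _; exact: g_ge0.
  apply: le_trans (l2_sum _ _ _ _) _.
  by apply: ler_sum => u _; exact: l2_le_Phi.
rewrite exchange_big /=.
under eq_bigr do rewrite exchange_big /=.
rewrite exchange_big /=.
(* [532 = 100 + 432] collects the tangent and the envelope terms; the 6 is that of [sum_Phi_g]. *)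
have -> : M%:R * (3192 * \sum_(u < M) l2 n (fun k => g k u))
  = 532 * M%:R * (6 * \sum_(u < M) l2 n (fun k => g k u)) by ring.
apply: (@le_trans _ _ (532 * M%:R * \sum_(k < n) \sum_(u < M) Phi (amp k u) (g k u))); last first.
  by rewrite ler_wpM2l ?mulr_ge0 ?ler0n // sum_Phi_g.
rewrite mulr_sumr; apply: ler_sum => k _.
have kn := ltn_ord k.
under eq_bigr do rewrite big_split /= sumr_const card_ord -mulr_natr.
rewrite big_split /= -mulr_suml.
set S := \sum_(u < M) Phi (amp k u) (g k u).
have q2 := sum_Phi_envelope kn; rewrite -/S in q2.
have LM : (M %/ N k * N k = M)%N by rewrite divnK // N_dvdM // ltnW.
have L0 : (0 < M %/ N k)%N by have := N_gt0 k; nia.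
have Ld : (M %/ N k %| M)%N by rewrite -{2}LM dvdn_mulr.
(* On a block [amp k] is nearly constant, so it may be moved to the point where [g k] is evaluated,
   and that point is uniformly distributed. *)
have q1 : \sum_(u < M) \sum_(v < M) Phi (amp k u) (W k u v) <= 100 * (S * M%:R).
  apply: (@le_trans _ _ (\sum_(u < M) \sum_(v < M)
     100 * Phi (amp k (blk (M %/ N k) u v)) (W k u v))).
    apply: ler_sum => u _; apply: ler_sum => v _.
    apply: Phi_scale; rewrite ?amp_ge0 //; first by lra.
    apply: amp_block; rewrite ?(ltnW kn) // chord_sym.
    by apply: chord_blk; rewrite ?(ltnW kn).
  under eq_bigr do rewrite -mulr_sumr.
  rewrite -mulr_sumr ler_wpM2l // /W.
  rewrite (sum_blk L0 Ld (fun x => Phi (amp k x) (g k x))).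
  by rewrite sumrMnl mulr_natr.
have : (\sum_(u < M) Phi (amp k u) (envelope k u)) * M%:R <= 432 * S * M%:R.
  by rewrite ler_wpM2r ?ler0n.
lra.
Qed.

End Decoupling.

(** * The multiplier on the grid *)

Section Multiplier.
Variables (R : rcfType) (M : nat) (w : R[i]).
Hypothesis M_gt0 : (0 < M)%N.
Hypothesis w_prim : M.-primitive_root w.
Implicit Types p : seq (nat * nat * R[i]).

Definition ev p (z1 z2 : R[i]) : R[i] :=
  \sum_(x <- p) x.2 * z1 ^+ x.1.1 * z2 ^+ x.1.2.

Definition evB p (m N : nat) (z1 z2 : R[i]) : R[i] :=
  \sum_(x <- p | (x.1.1 + x.1.2 == m)%N && (N %| x.1.1)%N)
    x.2 * z1 ^+ x.1.1 * z2 ^+ x.1.2.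

(* In the coordinates [z1 = z * s, z2 = s] the part of degree [m] is
   [s ^ m * slice m 1 z]. *)
Definition slice p (m N : nat) : {poly R[i]} :=
  \sum_(x <- p | (x.1.1 + x.1.2 == m)%N && (N %| x.1.1)%N) x.2 *: 'X^(x.1.1).

Lemma horner_slice p m N z : (slice p m N).[z] =
  \sum_(x <- p | (x.1.1 + x.1.2 == m)%N && (N %| x.1.1)%N) x.2 * z ^+ x.1.1.
Proof. by rewrite horner_sum; apply: eq_bigr => x _; rewrite hornerZ hornerXn. Qed.

Lemma size_slice p m N : (size (slice p m N) <= m.+1)%N.
Proof.
apply: leq_trans (size_sum _ _ _) _; apply/bigmax_leqP_seq => x _ /andP[/eqP e _].
by apply: leq_trans (size_scale_leq _ _) _; rewrite size_polyXn ltnS -e leq_addr.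
Qed.

Lemma evB_slice p m N z s : evB p m N (z * s) s = s ^+ m * (slice p m N).[z].
Proof.
rewrite horner_slice mulr_sumr; apply: eq_bigr => x /andP[/eqP <- _].
by rewrite exprMn exprD; ring.
Qed.

(** For fixed [z] a polynomial in [s] whose coefficients are the slices at [z]: the form to which
    Paley's inequality applies. *)
Definition radial p z : {poly R[i]} :=
  \sum_(x <- p) (x.2 * z ^+ x.1.1) *: 'X^(x.1.1 + x.1.2).

Lemma ev_radial p z s : ev p (z * s) s = (radial p z).[s].
Proof.
rewrite horner_sum; apply: eq_bigr => x _; rewrite hornerZ hornerXn exprMn exprD.
by ring.
Qed.

Lemma coef_radial p z m : (radial p z)`_m = (slice p m 1).[z].
Proof.
rewrite horner_slice coef_sum [RHS]big_mkcond; apply: eq_bigr => x _.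
by rewrite coefZ coefXn dvd1n andbT eq_sym; case: eqP => _; rewrite ?mulr1 ?mulr0.
Qed.

Lemma size_radial p z D : all (fun x => x.1.1 + x.1.2 <= D)%N p ->
  (size (radial p z) <= D.+1)%N.
Proof.
move=> /allP h; apply: leq_trans (size_sum _ _ _) _; apply/bigmax_leqP_seq => x xp _.
by apply: leq_trans (size_scale_leq _ _) _; rewrite size_polyXn ltnS h.
Qed.

Lemma sum_geom_root N (z : R[i]) : z ^+ N = 1 ->
  \sum_(i < N) z ^+ i = if z == 1 then N%:R else 0.
Proof.
move=> zN; case: eqP => [->|/eqP z1].
  by under eq_bigr do rewrite expr1n; rewrite sumr_const card_ord.
have z1' : z - 1 != 0 by rewrite subr_eq0.
by apply: (mulfI z1'); rewrite mulr0 -subrX1 zN subrr.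
Qed.

(** The points summed over are the products of [w ^ v] with the [N]-th roots of unity, each met
    [M / N] times. *)
Lemma sum_blk_grid N n v : (0 < N)%N -> (N %| M)%N ->
  \sum_(u < M) (w ^+ blk (M %/ N) u v) ^+ n
    = if (N %| n)%N then M%:R * (w ^+ v) ^+ n else 0.
Proof.
move=> N0 NM; set L := (M %/ N)%N.
have LM : (N * L = M)%N by rewrite mulnC divnK.
have L0 : (0 < L)%N by nia.
pose f i := (w ^+ (L * n)) ^+ i * (w ^+ (v %% L)) ^+ n.
have -> : \sum_(u < M) (w ^+ blk L u v) ^+ n = \sum_(u < N * L) f (u %/ L)%N.
  rewrite -[in LHS]LM; apply: eq_bigr => u _; rewrite /f /blk exprD exprMn.
  by congr (_ * _); rewrite -!exprM; congr (_ ^+ _); lia.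
rewrite (sum_div L0) sumrMnl -mulr_suml sum_geom_root; last first.
  by rewrite -exprM mulnAC [(L * N)%N]mulnC LM exprM (prim_expr_order w_prim) expr1n.
rewrite -(prim_order_dvd w_prim) -{1}LM [(N * L)%N]mulnC dvdn_pmul2l //.
case: ifP => Nn; last by rewrite mul0r mul0rn.
have -> : (w ^+ v) ^+ n = (w ^+ (v %% L)) ^+ n.
  rewrite {1}(divn_eq v L) exprD exprMn -!exprM.
  have /dvdnP[q ->] := Nn.
  have -> : (v %/ L * L * (q * N) = N * L * (v %/ L * q))%N by lia.
  by rewrite LM exprM (prim_expr_order w_prim) expr1n mul1r.
by rewrite -mulrnAl -[N%:R *+ L]mulr_natr -natrM LM.
Qed.

Lemma slice_avg p m N v : (0 < N)%N -> (N %| M)%N ->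
  M%:R * (slice p m N).[w ^+ v]
    = \sum_(u < M) (slice p m 1).[w ^+ blk (M %/ N) u v].
Proof.
move=> N0 NM; under eq_bigr do rewrite horner_slice.
rewrite exchange_big /= horner_slice mulr_sumr big_mkcond [RHS]big_mkcond.
apply: eq_bigr => x _; rewrite dvd1n andbT; case: eqP => //= _.
rewrite -mulr_sumr sum_blk_grid //; case: ifP => _; last by rewrite mulr0.
by rewrite mulrCA.
Qed.

Hypothesis chord_le : forall r, (r <= M)%N -> nm (w ^+ r - 1) <= 7 * r%:R / M%:R.
Hypothesis chord_ge : forall r, (r <= M)%N ->
  (minn r (M - r))%:R / M%:R <= nm (w ^+ r - 1).

(** Cauchy-Schwarz and Parseval in [s] on the left, decoupling in [u], Paley's inequality in [s] on
    the right; [12768 = 3192 * 4]. *)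
Theorem multiplier_bound p (d N : nat -> nat) n D :
  (0 < d 0)%N -> (forall k, (2 * d k < d k.+1)%N) ->
  (forall k, (0 < N k)%N) -> (forall k, (2 * N k <= N k.+1)%N) ->
  (forall k, (d k <= N k.+1)%N) ->
  (forall k, (k <= n)%N -> (N k %| M)%N) -> (2 * N n <= M)%N ->
  all (fun x => x.1.1 + x.1.2 <= D)%N p -> (D.+1 + psi_size d n <= M)%N ->
  \sum_(x < M) \sum_(y < M) nm (\sum_(k < n) evB p (d k) (N k) (w ^+ x) (w ^+ y))
    <= 12768 * \sum_(x < M) \sum_(y < M) nm (ev p (w ^+ x) (w ^+ y)).
Proof.
move=> d0 dl N0 N2 dN Nd NM pD DM.
have d_mono j k : (j < k)%N -> (d j < d k)%N.
  move=> jk; rewrite -(subnKC jk); elim: (k - j.+1)%N => [|i IH].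
    by rewrite addn0; have := dl j; lia.
  by rewrite addnS; have := dl (j.+1 + i)%N; lia.
have d_inj : {in gtn n &, injective d}.
  move=> j k _ _ e; case: (ltngtP j k) => // /d_mono; lia.
have dM k : (k < n)%N -> (d k < M)%N.
  move=> kn; apply: leq_trans DM; apply: leq_trans (leq_addl _ _).
  by apply: leq_trans (psi_size_mono d kn); rewrite /=; move: (psi_size d k) => t; lia.
have -> : \sum_(x < M) \sum_(y < M)
      nm (\sum_(k < n) evB p (d k) (N k) (w ^+ x) (w ^+ y))
    = \sum_(u < M) \sum_(s < M)
      nm (\sum_(k < n) (w ^+ s) ^+ d k * (slice p (d k) (N k)).[w ^+ u]).
  rewrite (sum_grid2 M_gt0 w_prim
    (fun z1 z2 => nm (\sum_(k < n) evB p (d k) (N k) z1 z2))).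
  apply: eq_bigr => u _; apply: eq_bigr => s _; congr nm.
  by apply: eq_bigr => k _; exact: evB_slice.
have -> : \sum_(x < M) \sum_(y < M) nm (ev p (w ^+ x) (w ^+ y))
    = \sum_(u < M) \sum_(s < M) nm (radial p (w ^+ u)).[w ^+ s].
  rewrite (sum_grid2 M_gt0 w_prim (fun z1 z2 => nm (ev p z1 z2))).
  by apply: eq_bigr => u _; apply: eq_bigr => s _; rewrite ev_radial.
apply: (@le_trans _ _ (\sum_(u < M) M%:R *
   l2 n (fun k => nm (slice p (d k) (N k)).[w ^+ u]))).
  apply: ler_sum => u _.
  exact: (lacunary_sum_le M_gt0 w_prim (fun k => (slice p (d k) (N k)).[w ^+ u])).
have dec : \sum_(v < M) l2 n (fun k => nm (slice p (d k) (N k)).[w ^+ v])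
    <= 3192 * \sum_(u < M) l2 n (fun k => nm (slice p (d k) 1).[w ^+ u]).
  apply: (@decoupling R M w M_gt0 w_prim chord_le chord_ge n N
    (fun k u => nm (slice p (d k) 1).[w ^+ u]) _ N0 N2 Nd _
    (fun k v => nm (slice p (d k) (N k)).[w ^+ v])).
  - by move=> k u; exact: nm_ge0.
  - move=> k u kn uM; apply: reproducing => //.
      by apply: leq_trans NM; rewrite leq_mul2l /= (N_le N2).
    by apply: leq_trans (size_slice _ _ _) _; rewrite ltnS.
  - by move=> k v; exact: nm_ge0.
  move=> k v kn vM; rewrite -nm_nat -nmM slice_avg ?Nd // 1?ltnW //.
  exact: nm_sum.
rewrite -mulr_sumr.
have MR : 0 <= M%:R :> R by rewrite ler0n.
apply: le_trans (ler_wpM2l MR dec) _.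
have -> : 12768 = 3192 * 4 :> R by ring.
rewrite mulrCA -mulrA ler_wpM2l // mulr_sumr mulr_sumr; apply: ler_sum => u _.
have sz : (size (radial p (w ^+ u)) + psi_size d n <= M)%N.
  by apply: leq_trans DM; rewrite leq_add2r size_radial.
have := paley M_gt0 w_prim d0 dl sz.
rewrite (_ : l2 n (fun k => nm (radial p (w ^+ u))`_(d k))
   = l2 n (fun k => nm (slice p (d k) 1).[w ^+ u])) //.
by congr (Num.sqrt _); apply: eq_bigr => k _; rewrite coef_radial.
Qed.

End Multiplier.

(** * Test polynomials *)

Lemma sum_mod (T : nmodType) (f : nat -> T) (N L : nat) :
  \sum_(u < N * L) f (u %% L)%N = (\sum_(r < L) f r) *+ N.
Proof.
elim: N => [|N IH]; first by rewrite mul0n big_ord0 mulr0n.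
rewrite mulSnr big_split_ord /= IH mulrSr; congr (_ + _).
by apply: eq_bigr => r _ /=; rewrite modnMDl modn_small.
Qed.

Lemma dvdn_div2 x y z : (0 < y)%N -> (x %| y)%N -> (y %| z)%N -> (z %/ y %| z %/ x)%N.
Proof.
move=> y0 /dvdnP[q yE] /dvdnP[k ->]; rewrite mulnK // yE mulnA mulnK ?dvdn_mulr //.
by move: y0; rewrite yE muln_gt0 => /andP[].
Qed.

(** * Summation by parts over the first index *)

Section FirstIndex.
Variables (R : rcfType) (N : nat -> nat).

(* Summation by parts of [1 / N j] for the first index [j] with [c j]. *)
Definition weight a (c : nat -> bool) : R :=
  (N a)%:R^-1 + \sum_(j < a) (c j)%:R * ((N j)%:R^-1 - (N j.+1)%:R^-1).

(** As [c] is monotone, the sum telescopes from the first [j] with [c j] and leaves [1 / N j]. *)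
Lemma weight_le a (c : nat -> bool) : (forall j, (j < a)%N -> c j -> c j.+1) -> c a ->
  exists2 j, (j <= a)%N & c j /\ weight a c <= (N j)%:R^-1.
Proof.
elim: a => [|a IH] cm ca.
  by exists 0%N => //; split=> //; rewrite /weight big_ord0 addr0.
case: (boolP (c a)) => [ca'|nca].
  have [j ja [cj wj]] := IH (fun j ja => cm j (ltnW ja)) ca'.
  exists j; rewrite ?leqW //; split=> //; apply: le_trans wj.
  rewrite /weight big_ord_recr /= ca' mul1r; lra.
exists a.+1 => //; split=> //; rewrite /weight big1 ?addr0 // => j _.
suff /negbTE -> : ~~ c j by rewrite mul0r.
move: (nat_of_ord j) (ltn_ord j) => {}j; rewrite ltnS => ja.
apply: contra nca => cj.
have H i : (j + i <= a)%N -> c (j + i)%N.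
  elim: i => [|i IHi] h; first by rewrite addn0.
  by rewrite addnS; apply: cm; [lia|apply: IHi; lia].
by rewrite -(subnKC ja); apply: H; rewrite subnKC.
Qed.

Hypothesis N_gt0 : forall k, (0 < N k)%N.
Hypothesis N_double : forall k, (2 * N k <= N k.+1)%N.

(** Each of the [a] terms is [1 - N j / N j.+1 >= 1/2]; this gives the lower bound its linear growth
    in [a]. *)
Lemma weight_sum a :
  1 + a%:R / 2 <= (N a)%:R * (N a)%:R^-1
    + \sum_(j < a) (N j)%:R * ((N j)%:R^-1 - (N j.+1)%:R^-1) :> R.
Proof.
have n0 j : (N j)%:R != 0 :> R by rewrite pnatr_eq0 -lt0n.
have -> : a%:R / 2 = \sum_(j < a) 2^-1 :> R by rewrite sumr_const card_ord mulr_natl.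
rewrite divff // lerD2l; apply: ler_sum => j _.
rewrite mulrBr divff //.
have : (N j)%:R / (N j.+1)%:R <= 2^-1 :> R.
  rewrite ler_pdivrMr ?ltr0n // mulrC ler_pdivlMr // -natrM ler_nat mulnC.
  exact: N_double.
lra.
Qed.
End FirstIndex.

Section TestPolynomial.
Variables (R : rcfType) (M : nat) (w : R[i]).
Hypothesis M_gt0 : (0 < M)%N.
Hypothesis w_prim : M.-primitive_root w.

Variables (d : nat -> nat).
Hypothesis d_mono : forall j k, (j < k)%N -> (d j < d k)%N.

(** In the coordinates [z1 = z s], [z2 = s] this is [g(z)] times the sum of the [s ^ d (k0 + j)].
    The truncated subtraction is exact once [g] has degree at most [d k0]. *)
Definition testpoly (g : {poly R[i]}) (k0 n : nat) : seq (nat * nat * R[i]) :=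
  [seq ((i, (d (k0 + j) - i)%N), g`_i) | j <- iota 0 n, i <- iota 0 (size g)].

Lemma d_le j k : (j <= k)%N -> (d j <= d k)%N.
Proof. by rewrite leq_eqVlt => /orP[/eqP -> //|/d_mono/ltnW]. Qed.

Lemma d_inj : injective d.
Proof. by move=> j k e; case: (ltngtP j k) => // /d_mono; rewrite e ltnn. Qed.

Variables (g : {poly R[i]}) (k0 n : nat).
Hypothesis g_size : (size g <= (d k0).+1)%N.

Lemma horner_iota z : \sum_(i <- iota 0 (size g)) g`_i * z ^+ i = g.[z].
Proof.
by rewrite horner_coef -[RHS](big_mkord xpredT (fun i => g`_i * z ^+ i)) /index_iota subn0.
Qed.

Lemma deg_test j i : i \in iota 0 (size g) -> (i + (d (k0 + j) - i) = d (k0 + j))%N.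
Proof.
rewrite mem_iota add0n => /andP[_ ig]; rewrite subnKC //.
by apply: leq_trans (d_le (leq_addr j k0)); rewrite -ltnS; apply: leq_trans g_size.
Qed.

Lemma testpoly_deg : all (fun x => (x.1.1 + x.1.2 < d (k0 + n))%N) (testpoly g k0 n).
Proof.
apply/allP => x /allpairsP[[j i]] /= [jn ig ->] /=.
rewrite deg_test // d_mono // ltn_add2l.
by move: jn; rewrite mem_iota add0n.
Qed.

Lemma slice_testpoly j z : (j < n)%N ->
  (slice (testpoly g k0 n) (d (k0 + j)) 1).[z] = g.[z].
Proof.
move=> jn; rewrite horner_slice big_mkcond big_allpairs_dep /=.
rewrite (bigD1_seq j) ?mem_iota ?iota_uniq //= [X in _ + X]big1_seq ?addr0.
  rewrite -horner_iota; apply: eq_big_seq => i ig.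
  by rewrite deg_test // eqxx dvd1n.
move=> j' /andP[ne _]; rewrite big1_seq // => i /andP[_ ig].
rewrite deg_test //; case: eqP => //= /d_inj e; move: ne; rewrite -(eqn_add2l k0).
by rewrite e eqxx.
Qed.

Lemma ev_testpoly z s :
  ev (testpoly g k0 n) (z * s) s = \sum_(j < n) s ^+ d (k0 + j) * g.[z].
Proof.
rewrite /ev big_allpairs_dep /= -[RHS](big_mkord xpredT (fun j => s ^+ d (k0 + j) * g.[z])).
rewrite /index_iota subn0; apply: eq_bigr => j _.
rewrite -horner_iota mulr_sumr; apply: eq_big_seq => i ig.
by rewrite -[in RHS](deg_test j ig) exprMn exprD; ring.
Qed.

(** The factor [g(z)] does not depend on [j], so the square function is [sqrt n] times its
    modulus. *)
Lemma testpoly_norm : (d (k0 + n) <= M)%N ->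
  \sum_(x < M) \sum_(y < M) nm (ev (testpoly g k0 n) (w ^+ x) (w ^+ y))
    <= M%:R * Num.sqrt n%:R * \sum_(u < M) nm g.[w ^+ u].
Proof.
move=> dM.
rewrite (sum_grid2 M_gt0 w_prim (fun z1 z2 => nm (ev (testpoly g k0 n) z1 z2))).
rewrite mulr_sumr; apply: ler_sum => u _.
under eq_bigr do rewrite ev_testpoly.
have inj : {in gtn n &, injective (fun j => d (k0 + j))}.
  by move=> i j _ _ /d_inj/addnI.
have lt k : (k < n)%N -> (d (k0 + k) < M)%N.
  by move=> kn; apply: leq_trans dM; apply: d_mono; rewrite ltn_add2l.
apply: le_trans (lacunary_sum_le M_gt0 w_prim (fun=> g.[w ^+ u]) inj lt) _.
rewrite -mulrA ler_wpM2l ?ler0n // /l2 sumr_const card_ord -[nm _ ^+ 2 *+ n]mulr_natl.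
by rewrite sqrtrM ?ler0n // sqrtr_sqr ger0_norm ?nm_ge0.
Qed.

End TestPolynomial.

Section Dirichlet.
Variable R : rcfType.

Definition dirichlet m : {poly R[i]} := \sum_(i < m) 'X^i.

Lemma horner_dirichlet m z : (dirichlet m).[z] = \sum_(i < m) z ^+ i.
Proof. by rewrite horner_sum; apply: eq_bigr => i _; rewrite hornerXn. Qed.

Lemma size_dirichlet_sqr m : (size (dirichlet m.+1 ^+ 2) <= (2 * m).+1)%N.
Proof.
have s : (size (dirichlet m.+1) <= m.+1)%N.
  apply: leq_trans (size_sum _ _ _) _; apply/bigmax_leqP => i _.
  by rewrite size_polyXn.
apply: leq_trans (size_polyMleq _ _) _; rewrite mul2n -addnn.
by move: (size _) s => t; lia.
Qed.
End Dirichlet.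

(** * The lower bound for the test polynomial *)

Section LowerBound.
Variables (R : rcfType) (M : nat) (w : R[i]).
Hypothesis M_gt0 : (0 < M)%N.
Hypothesis w_prim : M.-primitive_root w.
Hypothesis chord_le : forall r, (r <= M)%N -> nm (w ^+ r - 1) <= 7 * r%:R / M%:R.

(** The Fejer kernel without its normalising factor [1 / m]. *)
Definition fejer m x : R := nm (dirichlet R m).[w ^+ x] ^+ 2.

Lemma fejer_ge0 m x : 0 <= fejer m x. Proof. exact: sqr_ge0. Qed.

Lemma sum_fejer m : (m <= M)%N -> \sum_(x < M) fejer m x = M%:R * m%:R.
Proof.
move=> mM.
have := parseval M_gt0 w_prim (n := m) (d := id) (fun=> 1).
rewrite (eq_bigr (fun x : 'I_M => fejer m x)) => [->|x _].
- by under eq_bigr do rewrite nm1 expr1n; rewrite sumr_const card_ord.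
- by move=> i j _ _.
- by move=> k km; apply: leq_trans mM.
by rewrite /fejer horner_dirichlet; under eq_bigr do rewrite mulr1.
Qed.

(* On the circle [dirichlet R m.+1] equals its conjugate times [z ^+ m]. *)
Lemma dirichlet_sqr m x :
  (dirichlet R m.+1 ^+ 2).[w ^+ x] = (w ^+ x) ^+ m * (fejer m.+1 x)%:C.
Proof.
rewrite horner_exp /fejer -mul_cj expr2 mulrCA; congr (_ * _).
rewrite !horner_dirichlet cj_sum mulr_sumr (reindex_inj rev_ord_inj) /=.
apply: eq_bigr => i _; rewrite subSS.
have im : (i <= m)%N by rewrite -ltnS.
have -> : (w ^+ x) ^+ m = (w ^+ x) ^+ (m - i) * (w ^+ x) ^+ i by rewrite -exprD subnK.
by rewrite -mulrA (gridXJ M_gt0 w_prim) mulr1.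
Qed.

(** This close to 1, every term of the Dirichlet sum is within 1/2 of 1. *)
Lemma fejer_near0 m r : (14 * m * r <= M)%N -> m%:R ^+ 2 / 4 <= fejer m r.
Proof.
case: (posnP m) => [-> _|m0 h]; first by rewrite expr0n /= mul0r fejer_ge0.
have MR : 0 < M%:R :> R by rewrite ltr0n.
have rM : (r <= M)%N by nia.
have c := chord_le rM.
have step i : nm ((w ^+ r) ^+ i - 1) <= i%:R * nm (w ^+ r - 1).
  rewrite subrX1 nmM mulrC ler_wpM2r ?nm_ge0 //.
  apply: le_trans (nm_sum _ _ _) _.
  under eq_bigr do rewrite (nm_gridX M_gt0 w_prim).
  by rewrite sumr_const card_ord.
have dist : nm ((dirichlet R m).[w ^+ r] - m%:R) <= m%:R / 2.
  rewrite horner_dirichlet -[X in _ - X%:R]card_ord -sumr_const -sumrB.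
  apply: le_trans (nm_sum _ _ _) _.
  apply: (@le_trans _ _ (\sum_(i < m) 2^-1)); last first.
    by rewrite sumr_const card_ord mulr_natl.
  apply: ler_sum => i _; apply: le_trans (step i) _.
  apply: (@le_trans _ _ (m%:R * (7 * r%:R / M%:R))).
    by apply: ler_pM; rewrite ?ler0n ?nm_ge0 // ler_nat ltnW.
  rewrite mulrA ler_pdivrMr //.
  have : (14 * m * r)%:R <= M%:R :> R by rewrite ler_nat.
  rewrite !natrM; lra.
have : m%:R <= nm (dirichlet R m).[w ^+ r] + m%:R / 2.
  have := nmD (dirichlet R m).[w ^+ r] (m%:R - (dirichlet R m).[w ^+ r]).
  by rewrite addrC subrK nm_nat => /le_trans; apply; rewrite lerD2l nmB.
rewrite /fejer; have := ler0n R m; nra.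
Qed.

Variables (d N : nat -> nat) (k0 a : nat).
Hypothesis d_mono : forall j k, (j < k)%N -> (d j < d k)%N.
Hypothesis N_gt0 : forall k, (0 < N k)%N.
Hypothesis N_double : forall k, (2 * N k <= N k.+1)%N.
Hypothesis N_dvd : forall k, (N k %| N k.+1)%N.
Hypothesis big_d : (2 * N (k0 + a) <= d k0)%N.
Hypothesis M_dvd : (14 * (N (k0 + a)).+1 * N (k0 + a) %| M)%N.
Hypothesis d_M : (d (k0 + a.+1) <= M)%N.

Let Q := N (k0 + a).
(** The factor is [z ^ Q] times a Fejer kernel, and its degree [2 * Q] fits below [d k0] by [big_d].
    Every [N (k0 + j)] with [j <= a] divides [Q], so the averages leave [z ^ Q] untouched. *)
Let p := testpoly d (dirichlet R Q.+1 ^+ 2) k0 a.+1.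

Lemma N_dvd_le j k : (j <= k)%N -> (N j %| N k)%N.
Proof.
move/subnKC <-; elim: (k - j)%N => [|i IH]; rewrite ?addn0 // addnS.
exact: dvdn_trans IH _.
Qed.

Lemma size_g : (size (dirichlet R Q.+1 ^+ 2) <= (d k0).+1)%N.
Proof. by apply: leq_trans (size_dirichlet_sqr _ _) _; rewrite ltnS. Qed.

Lemma testpoly_upper :
  \sum_(x < M) \sum_(y < M) nm (ev p (w ^+ x) (w ^+ y))
    <= M%:R ^+ 2 * Q.+1%:R * Num.sqrt a.+1%:R.
Proof.
apply: le_trans (testpoly_norm M_gt0 w_prim d_mono size_g d_M) _.
have -> : \sum_(u < M) nm (dirichlet R Q.+1 ^+ 2).[w ^+ u] = M%:R * Q.+1%:R.
  rewrite -sum_fejer; last first.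
    have := dvdn_leq M_gt0 M_dvd; have := N_gt0 (k0 + a); rewrite -/Q; nia.
  by apply: eq_bigr => u _; rewrite horner_exp nmX.
by rewrite le_eqVlt; apply/orP; left; apply/eqP; ring.
Qed.

Lemma Q_dvd : (Q %| M)%N.
Proof. by apply: dvdn_trans M_dvd; rewrite dvdn_mull. Qed.

Lemma N_dvdQ j : (j <= a)%N -> (N (k0 + j) %| Q)%N.
Proof. by move=> ja; apply: N_dvd_le; rewrite leq_add2l. Qed.

Lemma N_dvdM j : (j <= a)%N -> (N (k0 + j) %| M)%N.
Proof. by move=> ja; apply: dvdn_trans (N_dvdQ ja) Q_dvd. Qed.

(** The modulation [z ^ Q] is constant on the points averaged over; the rest is an average of
    nonnegative values, of which one is kept. *)
Lemma slice_lower j v : (j <= a)%N ->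
  fejer Q.+1 (v %% (M %/ N (k0 + j))) / (N (k0 + j))%:R
    <= nm (slice p (d (k0 + j)) (N (k0 + j))).[w ^+ v].
Proof.
move=> ja; have MR : 0 < M%:R :> R by rewrite ltr0n.
have NR : 0 < (N (k0 + j))%:R :> R by rewrite ltr0n.
set L := (M %/ N (k0 + j))%N.
have LM : (N (k0 + j) * L = M)%N by rewrite mulnC divnK // N_dvdM.
have L0 : (0 < L)%N by have := N_gt0 (k0 + j); nia.
rewrite -(ler_pM2l MR) -nm_nat -nmM slice_avg ?N_dvdM // -/L.
have -> : \sum_(u < M) (slice p (d (k0 + j)) 1).[w ^+ blk L u v]
   = (w ^+ v) ^+ Q * (\sum_(u < M) fejer Q.+1 (blk L u v))%:C.
  rewrite rmorph_sum mulr_sumr; apply: eq_bigr => u _.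
  rewrite slice_testpoly ?ltnS //; last exact: size_g.
  rewrite dirichlet_sqr; congr (_ * _).
  have /dvdnP[q Qq] := N_dvdQ ja.
  have e x : (w ^+ (x * L)) ^+ Q = 1.
    rewrite -exprM Qq (_ : x * L * (q * N (k0 + j)) = N (k0 + j) * L * (x * q))%N; last lia.
    by rewrite LM exprM (prim_expr_order w_prim) expr1n.
  rewrite /blk exprD exprMn e mul1r {2}(divn_eq v L) exprD exprMn e mul1r.
  by [].
rewrite nmM (nm_gridX M_gt0 w_prim) mul1r nmR.
have s0 : 0 <= \sum_(u < M) fejer Q.+1 (blk L u v).
  by apply: sumr_ge0 => u _; exact: fejer_ge0.
rewrite ger0_norm // nm_nat -[in X in _ <= X]LM.
rewrite (sum_div L0 (fun i => fejer Q.+1 (i * L + v %% L))).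
set F := fejer Q.+1 (v %% L).
have -> : M%:R * (F / (N (k0 + j))%:R) = F *+ L.
  by rewrite -[in LHS]LM natrM -[RHS]mulr_natr; field; rewrite gt_eqF.
rewrite (bigD1 (Ordinal (N_gt0 (k0 + j)))) //= mul0n add0n lerDl.
by apply: sumr_ge0 => i _; rewrite mulrn_wge0 // fejer_ge0.
Qed.

Let ell := (M %/ Q)%N.

Lemma ell_dvd j : (j <= a)%N -> (ell %| M %/ N (k0 + j))%N.
Proof.
by move=> ja; apply: dvdn_div2 (N_dvdQ ja) Q_dvd; exact: N_gt0.
Qed.

(** For each [v] only one degree is kept, with an index [j] such that [c v j]. The weight [W v]
    bounds the resulting [1 / N (k0 + j)] from below by a sum over all indices, which can then be
    summed over [v]. *)
Theorem testpoly_lower :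
  M%:R ^+ 2 * Q.+1%:R / 56 * (1 + a%:R / 2) <=
  \sum_(x < M) \sum_(y < M)
     nm (\sum_(k < k0 + a.+1) evB p (d k) (N k) (w ^+ x) (w ^+ y)).
Proof.
have MR : 0 < M%:R :> R by rewrite ltr0n.
have Q0 : (0 < Q)%N by exact: N_gt0.
have ellM : (ell * Q = M)%N by rewrite divnK // Q_dvd.
have ell0 : (0 < ell)%N by nia.
(* [w ^ v] lies fewer than [ell] steps after an [N (k0 + j)]-th root of unity; this persists when
   [j] grows. *)
pose c v j := (v %% (M %/ N (k0 + j)) < ell)%N.
pose W v := weight R (fun j => N (k0 + j)) a (c v).
rewrite (sum_grid2 M_gt0 w_prim
  (fun z1 z2 => nm (\sum_(k < k0 + a.+1) evB p (d k) (N k) z1 z2))).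
apply: (@le_trans _ _ (\sum_(v < M) M%:R * (fejer Q.+1 (v %% ell) * W v))); last first.
  apply: ler_sum => v _.
  have mono j : (j < a)%N -> c v j -> c v j.+1.
    move=> ja; rewrite /c addnS => cj.
    have dv : (M %/ N (k0 + j).+1 %| M %/ N (k0 + j))%N.
      apply: dvdn_div2 (N_dvd _) _; rewrite ?N_gt0 // -addnS.
      exact: N_dvdM.
    rewrite -(modn_dvdm v dv) modn_small //.
    apply: leq_trans cj _; apply: dvdn_leq; last by rewrite -addnS ell_dvd.
    by rewrite divn_gt0 ?N_gt0 // dvdn_leq // -addnS N_dvdM.
  have ca : c v a by rewrite /c -/Q -/ell ltn_pmod.
  have [j ja [cj Wj]] := @weight_le R (fun j => N (k0 + j)) a (c v) mono ca.
  have inj : {in gtn (k0 + a.+1) &, injective d}.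
    by move=> i j' _ _; exact: (d_inj d_mono).
  have lt k : (k < k0 + a.+1)%N -> (d k < M)%N.
    by move=> kn; apply: leq_trans d_M; apply: d_mono.
  under eq_bigr do under eq_bigr do rewrite evB_slice.
  have kn : (k0 + j < k0 + a.+1)%N by rewrite ltn_add2l ltnS.
  apply: le_trans (lacunary_sum_ge M_gt0 w_prim
    (fun k => (slice p (d k) (N k)).[w ^+ v]) inj lt kn).
  rewrite ler_wpM2l ?(ltW MR) //; apply: le_trans (slice_lower v ja).
  have e : (v %% (M %/ N (k0 + j)) = v %% ell)%N.
    by rewrite -(modn_dvdm v (ell_dvd ja)) [RHS]modn_small.
  by rewrite e ler_wpM2l ?fejer_ge0.
rewrite -mulr_sumr.
pose S := \sum_(r < ell) fejer Q.+1 r.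
(* Each of the [N (k0 + j)] blocks contributes [S]. *)
have cnt j : (j <= a)%N ->
    \sum_(v < M) fejer Q.+1 (v %% ell) * (c v j)%:R = S * (N (k0 + j))%:R.
  move=> ja; set L := (M %/ N (k0 + j))%N.
  have LM : (N (k0 + j) * L = M)%N by rewrite mulnC divnK // N_dvdM.
  have lL : (ell <= L)%N.
    by apply: dvdn_leq (ell_dvd ja); rewrite divn_gt0 // dvdn_leq // N_dvdM.
  transitivity (\sum_(v < N (k0 + j) * L)
      (fun x => if (x < ell)%N then fejer Q.+1 x else 0) (v %% L)%N).
    rewrite -[in LHS]LM; apply: eq_bigr => v _; rewrite /c -/L.
    case: ifP => h; last by rewrite mulr0.
    by rewrite mulr1 -(modn_dvdm v (ell_dvd ja)) modn_small.
  rewrite (sum_mod (fun x => if (x < ell)%N then fejer Q.+1 x else 0)).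
  rewrite -[LHS]mulr_natr; congr (_ * _).
  by rewrite -big_mkcond /= -(big_ord_widen L (fun x => fejer Q.+1 x) lL).
have tot : S * (1 + a%:R / 2) <= \sum_(v < M) fejer Q.+1 (v %% ell) * W v.
  have -> : \sum_(v < M) fejer Q.+1 (v %% ell) * W v = S *
     ((N (k0 + a))%:R * (N (k0 + a))%:R^-1 + \sum_(j < a)
        (N (k0 + j))%:R * ((N (k0 + j))%:R^-1 - (N (k0 + j.+1))%:R^-1)).
    rewrite /W /weight; under eq_bigr do rewrite mulrDr mulr_sumr.
    rewrite big_split /= mulrDr; congr (_ + _).
      rewrite mulrA -cnt // mulr_suml; apply: eq_bigr => v _.
      by rewrite /c -/Q -/ell ltn_pmod // mulr1.
    rewrite exchange_big mulr_sumr; apply: eq_bigr => j _.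
    rewrite [RHS]mulrA -cnt ?mulr_suml; last exact: ltnW.
    by apply: eq_bigr => v _; rewrite mulrA.
  have S0 : 0 <= S by apply: sumr_ge0 => r _; exact: fejer_ge0.
  rewrite ler_wpM2l //.
  apply: (@weight_sum R (fun j => N (k0 + j))) => j //.
  by rewrite addnS.
(* The first [M / (14 (Q + 1))] points each carry at least [(Q + 1)^2 / 4], whence [56 = 14 * 4]. *)
have Sb : M%:R * Q.+1%:R / 56 <= S.
  have /dvdnP[t tE] : (14 * Q.+1 %| M)%N by apply: dvdn_trans M_dvd; exact: dvdn_mulr.
  have tl : (t <= ell)%N by nia.
  apply: (@le_trans _ _ (\sum_(r < t) fejer Q.+1 r)).
    apply: (@le_trans _ _ (\sum_(r < t) Q.+1%:R ^+ 2 / 4)).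
      rewrite sumr_const card_ord -mulr_natl tE !natrM.
      by rewrite le_eqVlt; apply/orP; left; apply/eqP; field.
    apply: ler_sum => r _; apply: fejer_near0; rewrite tE mulnC leq_mul2r.
    by rewrite ltnW ?orbT.
  rewrite /S (big_ord_widen ell (fun x => fejer Q.+1 x) tl).
  rewrite [leRHS](bigID (fun r : 'I_ell => (r < t)%N)) /= lerDl.
  by apply: sumr_ge0 => r _; exact: fejer_ge0.
apply: le_trans (ler_wpM2l (ltW MR) tot).
rewrite mulrA ler_wpM2r //; first by rewrite addr_ge0 ?divr_ge0 ?ler0n.
have -> : M%:R ^+ 2 * Q.+1%:R / 56 = M%:R * (M%:R * Q.+1%:R / 56) :> R by ring.
by rewrite ler_wpM2l ?(ltW MR).
Qed.

End LowerBound.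

(** * From the grid to the torus *)

Notation RR := Rdefinitions.R.

Definition expi (t : RR) : RR[i] := Complex (cos t) (sin t).

Lemma expiD s t : expi (s + t)%R = expi s * expi t.
Proof.
apply/eqP; rewrite eq_complex /= -!RealsE cos_plus sin_plus.
by apply/andP; split; apply/eqP; rewrite !RealsE; ring.
Qed.

Lemma expiX t n : expi t ^+ n = expi (n%:R * t)%R.
Proof.
elim: n => [|n IH]; first by rewrite expr0 mul0r /expi cos_0 sin_0.
by rewrite exprS IH -expiD; congr expi; rewrite -natr1; ring.
Qed.

Definition gridroot (M : nat) : RR[i] := expi (2 * PI / M%:R)%R.

Section GridRoot.
Variable M : nat.
Hypothesis M_gt0 : (0 < M)%N.
Let w := gridroot M.

Lemma nm_gridroot r : nm (w ^+ r - 1) = `|2 * sin (r%:R * (2 * PI / M%:R) / 2)%R|%R.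
Proof.
rewrite /w expiX /nm /=.
have := chord_sqr (r%:R * (2 * PI / M%:R))%R; rewrite !RealsE oppr0 addr0 => ->.
by rewrite sqrtr_sqr.
Qed.

Lemma gridroot_chord_le r : (r <= M)%N -> nm (w ^+ r - 1) <= 7 * r%:R / M%:R.
Proof.
move=> /ssrnat.leP rM; rewrite nm_gridroot; apply/RleP.
have := chord_upper M r (ssrnat.leP M_gt0) rM; rewrite !RealsE => h; exact: h.
Qed.

Lemma gridroot_chord_ge r : (r <= M)%N ->
  (minn r (M - r))%:R / M%:R <= nm (w ^+ r - 1).
Proof.
move=> /ssrnat.leP rM; rewrite nm_gridroot; apply/RleP.
have := chord_lower M r (ssrnat.leP M_gt0) rM; rewrite !RealsE.
by rewrite (_ : Nat.min r (M - r) = minn r (M - r)) //; lia.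
Qed.

(** By the lower bound for chords no smaller positive power of [w] equals 1. *)
Lemma gridroot_prim : M.-primitive_root w.
Proof.
have wM : w ^+ M = 1.
  rewrite expiX mulrC divfK ?pnatr_eq0 -?lt0n //.
  by have := cos_2PI; have := sin_2PI; rewrite !RealsE /expi => -> ->.
apply/andP; split=> //; apply/forallP => -[i iM] /=.
rewrite unity_rootE; apply/eqP; apply/eqP/eqP => [h|->] //.
case: (ltngtP i.+1 M) iM => // lt _.
have := gridroot_chord_ge (ltnW lt).
rewrite h subrr nm0 => {}h.
have : 0 < (minn i.+1 (M - i.+1))%:R / M%:R :> RR.
  by rewrite divr_gt0 ?ltr0n // leq_min subn_gt0 lt.
by rewrite ltNge h.
Qed.
End GridRoot.

Definition toC (c : C) : RR[i] := Complex c.1 c.2.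
Definition ofC (z : RR[i]) : C := (complex.Re z, complex.Im z).
Definition to_seq (p : trigpoly) : seq (nat * nat * RR[i]) :=
  [seq (x.1, toC x.2) | x <- p].
Definition of_seq (p : seq (nat * nat * RR[i])) : trigpoly :=
  [seq (x.1, ofC x.2) | x <- p].

Lemma of_seqK p : to_seq (of_seq p) = p.
Proof.
rewrite /to_seq /of_seq -map_comp -[RHS]map_id; apply: eq_map => -[n [a b]].
by rewrite /= /toC.
Qed.

Lemma toCD x y : toC (Cplus x y) = toC x + toC y. Proof. by []. Qed.
Lemma toCM x y : toC (Cmult x y) = toC x * toC y. Proof. by []. Qed.

Lemma nm_toC c : nm (toC c) = Cmod c.
Proof. by rewrite /Cmod RsqrtE !RealsE. Qed.

Lemma toC_eval p t1 t2 : toC (trig_eval p t1 t2) = ev (to_seq p) (expi t1) (expi t2).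
Proof.
elim: p => [|[[n1 n2] c] p IH]; first by rewrite /ev big_nil.
rewrite /ev /= big_cons /= -[in RHS]/(ev _ _ _) -IH toCD toCM; congr (_ + _).
rewrite -mulrA; congr (_ * _); rewrite !expiX -expiD /toC /eC /expi /=.
by rewrite !RealsE.
Qed.

Lemma nsumE f n : nsum f n = \sum_(i < n) f i.
Proof. by elim: n => [|n IH]; rewrite ?big_ord0 // big_ord_recr /= -IH. Qed.

Lemma grid_sumE p M : grid_sum p M =
  \sum_(x < M) \sum_(y < M) nm (ev (to_seq p) (gridroot M ^+ x) (gridroot M ^+ y)).
Proof.
rewrite /grid_sum nsumE; apply: eq_bigr => x _; rewrite nsumE; apply: eq_bigr => y _.
by rewrite -nm_toC toC_eval !expiX !RealsE.
Qed.

Lemma indP (E : nat -> nat -> Prop) a b : reflect (E a b) (Defs.ind E a b).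
Proof.
by rewrite /Defs.ind; case: ClassicalDescription.excluded_middle_informative => h; constructor.
Qed.

Section Spectrum.
Variables (d N : nat -> nat).
Hypothesis d_mono : forall j k, (j < k)%N -> (d j < d k)%N.

(** As [d] is injective, a frequency belongs to at most one [A_k], so the indicator of [B] is a sum
    over [k]; the degree bound cuts it at [n]. *)
Lemma ev_multiplier p n z1 z2 :
  all (fun x => x.1.1 + x.1.2 < d n)%N (to_seq p) ->
  ev (to_seq (multiplier (setB d N) p)) z1 z2
    = \sum_(k < n) evB (to_seq p) (d k) (N k) z1 z2.
Proof.
move=> /allP deg.
have -> : to_seq (multiplier (setB d N) p)
    = [seq x <- to_seq p | Defs.ind (setB d N) x.1.1 x.1.2].
  rewrite /to_seq filter_map; congr map.
  rewrite /multiplier; elim: (p) => //= -[[n1 n2] c] q -> /=.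
  by case: ifP.
rewrite /ev big_filter big_mkcond.
under [RHS]eq_bigr do rewrite /evB big_mkcond.
rewrite exchange_big /=; apply: eq_big_seq => x /deg xd.
case: indP => [[k [e dv]]|nB].
  have {}e : (x.1.1 + x.1.2 = d k)%N := e.
  have dvk : (N k %| x.1.1)%N by apply/dvdnP; case: dv => z ->; exists z.
  have kn : (k < n)%N.
    rewrite ltnNge; apply/negP => nk; move: xd; rewrite e ltnNge.
    by move: nk; rewrite leq_eqVlt => /orP[/eqP ->|/d_mono/ltnW ->] //; rewrite leqnn.
  rewrite (bigD1 (Ordinal kn)) //= [X in _ + X]big1 ?addr0.
    by rewrite e eqxx dvk.
  move=> j ne; case: eqP => //= ej; move: ne; rewrite -val_eqE /=.
  by rewrite (d_inj d_mono (etrans (esym ej) e)) eqxx.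
rewrite big1 // => k _; case: eqP => //= e; case: ifP => // /dvdnP[z ez].
by case: nB; exists k; split=> //; exists z.
Qed.
End Spectrum.

Lemma sum_stride (T : nmodType) (f : nat -> T) n s :
  \sum_(k < n * s) f k = \sum_(r < s) \sum_(j < n) f (j * s + r)%N.
Proof.
rewrite exchange_big; elim: n => [|n IH]; first by rewrite mul0n !big_ord0.
by rewrite mulSnr big_split_ord /= IH big_ord_recr.
Qed.

Definition degree (p : trigpoly) : nat := \max_(x <- to_seq p) (x.1.1 + x.1.2)%N.

Lemma degreeP p : all (fun x => x.1.1 + x.1.2 <= degree p)%N (to_seq p).
Proof.
by apply/allP => x xp; rewrite /degree (big_rem x) //= leq_maxl.
Qed.

(** * The two implications on the torus *)

Section Chain.
Variables (d N : nat -> nat).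
Hypothesis d_S : forall k, (d k < d k.+1)%coq_nat.
Hypothesis N_S : forall k, Nat.divide (N k) (N k.+1).
Hypothesis N_pos : forall k, (0 < N k)%coq_nat.
Hypothesis N_double : forall k, (2 * N k <= N k.+1)%coq_nat.

Let d_mono j k : (j < k)%N -> (d j < d k)%N.
Proof.
move=> jk; rewrite -(subnKC jk); elim: (k - j.+1)%N => [|i IH].
  by rewrite addn0; apply/ssrnat.ltP.
by rewrite addnS; apply: ltn_trans IH _; apply/ssrnat.ltP.
Qed.

Let d_ge k : (k <= d k)%N.
Proof. by elim: k => // k IH; apply: leq_ltn_trans IH _; apply/ssrnat.ltP. Qed.

Let N_gt0 k : (0 < N k)%N. Proof. exact/ssrnat.ltP. Qed.

Let N_2 k : (2 * N k <= N k.+1)%N. Proof. exact/ssrnat.leP. Qed.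

Let N_dvd k : (N k %| N k.+1)%N.
Proof. by apply/dvdnP; case: (N_S k) => z ->; exists z. Qed.

Let N_dvdle j k : (j <= k)%N -> (N j %| N k)%N.
Proof. exact: N_dvd_le. Qed.

(** The triangle inequality over the [s] residue classes of [k], each of which satisfies the
    hypotheses of [multiplier_bound]. *)
Theorem idempotent_of_stride s : (0 < s)%coq_nat ->
  (forall k, (d k <= N (k + s)%coq_nat)%coq_nat) ->
  (forall k, (2 * d k < d (k + s)%coq_nat)%coq_nat) ->
  (0 < d 0)%coq_nat -> in_idempotent_ring (setB d N).
Proof.
move=> /ssrnat.ltP s0 dN d2 /ssrnat.ltP d0.
exists (s%:R * 12768)%R => p.
(* Since [k <= d k], degrees up to [D] involve only indices below [n * s]. *)
set D := degree p; set n := D.+1.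
pose d' r j := d (j * s + r)%N; pose N' r j := N (j * s + r)%N.
pose B := (\sum_(r < s) (2 * N' r n + (D.+1 + psi_size (d' r) n)))%N.
(* Every [N' r k] with [k <= n] and [r < s] divides [N (n.+1 * s)]; [B] makes [M] large enough for
   all classes at once. *)
pose P M := (N (n.+1 * s) %| M)%N && (B <= M)%N.
apply: (le_of_grid_le p _ _ P).
- by apply/RleP; rewrite !RealsE mulr_ge0 ?ler0n.
- move=> m; exists (N (n.+1 * s) * (m + B))%N; split.
    by apply/ssrnat.leP; have := N_gt0 (n.+1 * s); nia.
  by rewrite /P dvdn_mulr //=; have := N_gt0 (n.+1 * s); nia.
move=> M /ssrnat.ltP M0 /andP[NM BM].
apply/RleP; rewrite !RealsE !grid_sumE.
set w := gridroot M.
have wp : M.-primitive_root w by exact: gridroot_prim.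
have deg : all (fun x => x.1.1 + x.1.2 < d (n * s))%N (to_seq p).
  apply/allP => x /(allP (degreeP p)) h; apply: leq_trans (d_ge _).
  by apply: leq_ltn_trans h _; rewrite -/D /n; nia.
apply: (@le_trans _ _ (\sum_(r < s) \sum_(x < M) \sum_(y < M)
    nm (\sum_(j < n) evB (to_seq p) (d' r j) (N' r j) (w ^+ x) (w ^+ y)))).
  rewrite [leRHS]exchange_big /=; apply: ler_sum => x _; rewrite [leRHS]exchange_big /=.
  apply: ler_sum => y _; rewrite (ev_multiplier N d_mono _ _ deg).
  rewrite (sum_stride (fun k => evB (to_seq p) (d k) (N k) (w ^+ x) (w ^+ y))).
  exact: nm_sum.
rewrite -mulrA mulr_natl -[X in _ *+ X]card_ord -sumr_const; apply: ler_sum => r _.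
have rs := ltn_ord r.
have Bd : (2 * N' r n + (D.+1 + psi_size (d' r) n) <= M)%N.
  by apply: leq_trans BM; rewrite /B (bigD1 r) //= leq_addr.
have shift j : (j.+1 * s + r = j * s + r + s)%N by lia.
have c1 := gridroot_chord_le M0; have c2 := gridroot_chord_ge M0.
apply: (multiplier_bound M0 wp c1 c2 (D := D)).
- by rewrite /d' mul0n add0n; case: (r : nat) => [|r'] //; apply: leq_ltn_trans (d_mono _).
- by move=> k; rewrite /d' shift; apply/ssrnat.ltP; exact: d2.
- by move=> k; exact: N_gt0.
- move=> k; rewrite /N' shift; apply: leq_trans (N_2 _) _; apply: dvdn_leq => //.
  by apply: N_dvdle; rewrite -addn1 leq_add2l.
- by move=> k; rewrite /d' /N' shift; apply/ssrnat.leP; exact: dN.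
- by move=> k kn; apply: dvdn_trans NM; apply: N_dvdle; nia.
- by apply: leq_trans Bd; exact: leq_addr.
- exact: degreeP.
- by apply: leq_trans Bd; exact: leq_addl.
Qed.

(** The two grid bounds for the test polynomial are compared and the common factor [Q.+1] cancels.
    [Rabs K] appears because the sign of [K] is not given. *)
Theorem idempotent_lower k0 a K :
  (2 * N (k0 + a)%coq_nat <= d k0)%coq_nat ->
  (forall p, Rle (L1norm (multiplier (setB d N) p)) (Rmult K (L1norm p))) ->
  Rle (Rdiv (Rplus R1 (Rdiv (INR a) (INR 2))) (INR 56)) (Rmult (Rabs K) (sqrt (INR (S a)))).
Proof.
rewrite !RealsE; move=> /ssrnat.leP big HK.
set Q := N (k0 + a)%N.
pose q := testpoly d (dirichlet RR Q.+1 ^+ 2) k0 a.+1.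
pose p := of_seq q.
pose P M := (14 * Q.+1 * Q %| M)%N && (d (k0 + a.+1) <= M)%N.
have Pu : unbounded P.
  move=> m; exists (14 * Q.+1 * Q * (m + d (k0 + a.+1)))%N.
  have Q0 : (0 < Q)%N := N_gt0 _.
  split; first by apply/ssrnat.leP; nia.
  by rewrite /P dvdn_mulr //=; nia.
have QR : 0 < Q.+1%:R :> RR by rewrite ltr0n.
have up : L1norm p <= Q.+1%:R * Num.sqrt a.+1%:R.
  apply/RleP; apply: (L1norm_le_grid _ _ _ Pu) => M /ssrnat.ltP M0 /andP[dv dM].
  apply/RleP; rewrite !RealsE grid_sumE of_seqK mulrA.
  exact: (testpoly_upper M0 (gridroot_prim M0) d_mono N_gt0 big dv dM).
have lo : Q.+1%:R / 56 * (1 + a%:R / 2) <= L1norm (multiplier (setB d N) p).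
  apply/RleP; apply: (L1norm_ge_grid _ _ _ Pu) => M /ssrnat.ltP M0 /andP[dv dM].
  apply/RleP; rewrite !RealsE grid_sumE !mulrA.
  have deg : all (fun x => x.1.1 + x.1.2 < d (k0 + a.+1))%N (to_seq p).
    rewrite of_seqK; apply: (testpoly_deg d_mono).
    by apply: leq_trans (size_dirichlet_sqr _ _) _; rewrite ltnS.
  under eq_bigr do under eq_bigr do rewrite (ev_multiplier N d_mono _ _ deg) of_seqK.
  exact: (testpoly_lower M0 (gridroot_prim M0) (gridroot_chord_le M0)
    d_mono N_gt0 N_2 N_dvd big dv dM).
have n0 : 0 <= L1norm p by apply/RleP; exact: L1norm_ge0.
have h : L1norm (multiplier (setB d N) p) <= K * L1norm p by apply/RleP; exact: HK.
apply/RleP.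
have h2 : K * L1norm p <= `|K| * (Q.+1%:R * Num.sqrt a.+1%:R).
  apply: (@le_trans _ _ (`|K| * L1norm p)); first by rewrite ler_wpM2r // ler_norm.
  by rewrite ler_wpM2l.
rewrite -(ler_pM2l QR).
have -> : Q.+1%:R * ((1 + a%:R / 2) / 56) = Q.+1%:R / 56 * (1 + a%:R / 2) :> RR by ring.
apply: le_trans lo _; apply: le_trans h _; apply: le_trans h2 _.
by rewrite mulrCA.
Qed.

End Chain.

End GridEstimates.

(** * Assembly of the two implications *)

Theorem theorem2p2 (d N : nat -> nat) :
  lacunary d ->
  (forall k, Nat.divide (N k) (N (S k))) ->
  (forall k, (N k < N (S k))%nat) ->
  ((exists (a : nat) (C : R), forall k, INR (d k) <= C * INR (N (k + a)%nat))
   <-> in_idempotent_ring (setB d N)).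
Proof.
intros Hd Hdiv Hlt.
assert (HN := divide_chain_double N Hdiv Hlt).
assert (Npos : forall k, (0 < N k)%nat) by (intros k; apply HN).
assert (Ndbl : forall k, (2 * N k <= N (S k))%nat) by (intros k; apply HN).
assert (dS := lacunary_S d Hd).
split.
- intros [a [C H]].
  destruct (stride_exists d N a C Hd Ndbl H) as [s [s0 [H1 H2]]].
  apply (GridEstimates.idempotent_of_stride dS Hdiv Npos Ndbl s0 H1 H2).
  apply (proj1 Hd).
- intros [K HK]; apply NNPP; intros Hno.
  (* As [(1 + a / 2) / 56 >= (1 + a) / 112], the lower estimate would give
     [sqrt (a + 1) <= 112 * Rabs K], which this [a] excludes. *)
  destruct (INR_unbounded ((112 * Rabs K) ^ 2)) as [a Ha].
  (* With [C = 2] a failing [k] has [2 * N (k + a) < d k], the room needed by the test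
     polynomial. *)
  apply Hno; exists a, 2; intros k.
  apply Rnot_lt_le; intros Hk.
  assert (big : (2 * N (k + a) <= d k)%nat).
  { apply INR_le; rewrite mult_INR; simpl (INR 2); lra. }
  assert (L := GridEstimates.idempotent_lower dS Hdiv Npos Ndbl big HK).
  replace (INR 56) with 56 in L by (simpl; lra).
  replace (INR 2) with 2 in L by (simpl; lra).
  rewrite S_INR in L.
  set (A := sqrt (INR a + 1)) in L.
  assert (a0 := pos_INR a).
  assert (A2 : A * A = INR a + 1) by (apply sqrt_sqrt; lra).
  assert (A0 : 0 < A) by (apply sqrt_lt_R0; lra).
  assert (K0 := Rabs_pos K).
  assert (A * A <= 112 * Rabs K * A) by lra.
  assert (A <= 112 * Rabs K) by (apply Rmult_le_reg_r with A; lra).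
  nra.
Qed.
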